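(* Let $b=\infty$ and fix $\ell>0$. Suppose $(\tau_0-E)u=0$ has a positive solution on $(a,\infty)$ and let $u_0$ be a minimal positive solution. Define $v_0$ by $$v_0(x)=u_0(x)\int_a^x\frac{dt}{p_0(t)u_0(t)^2},$$ and suppose that, as $x\to\infty$, $$p_0v_0^2\big(u_0^2\,\Delta q+(p_0u_0')^2\,\Delta p\big)=O(1),\qquad \lim_{x\to\infty}p_0v_0\,p_0u_0'\,\Delta p=\lim_{x\to\infty}p_0\,\Delta p=0,$$ and that $\rho=(p_0u_0v_0)^{-1}$ satisfies $\rho=o(1)$ and $\frac1\ell\int_0^\ell|\rho(x+t)-\rho(x)|\,dt=o(\rho(x))$. Then $\tau_1-E$ is oscillatory if $$\limsup_{x\to\infty}\frac1\ell\int_x^{x+\ell}p_0(t)v_0(t)^2\left(u_0(t)^2\,\Delta q(t)+(p_0(t)u_0'(t))^2\,\Delta p(t)\right)dt<-\frac14$$ and nonoscillatory if $$\liminf_{x\to\infty}\frac1\ell\int_x^{x+\ell}p_0(t)v_0(t)^2\left(u_0(t)^2\,\Delta q(t)+(p_0(t)u_0'(t))^2\,\Delta p(t)\right)dt>-\frac14 .$$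
   Context: Let $a\in\mathbb R$ and $\tau_j=\frac1r\left(-\frac{d}{dx}p_j\frac{d}{dx}+q_j\right)$, $j=0,1$, on $(a,b)$ with $b=\infty$, where the coefficients are real-valued with $p_j^{-1},q_j,r\in L^1_{loc}(a,b)$ and $p_j,r>0$. Standing assumptions: for both $\tau_0$ and $\tau_1$ the endpoint $a$ is regular (i.e. $q_j,p_j^{-1},r$ are integrable near $a$) and $b$ is limit point (i.e. $(\tau_j-z)u=0$ has, up to multiples, at most one solution which is in $L^2(r\,dx)$ near $b$). $E\in\mathbb R$. Notation: $\Delta p=\frac1{p_0}-\frac1{p_1}$, $\Delta q=q_1-q_0$. A positive solution $u_0$ of $(\tau_0-E)u_0=0$ is called minimal (principal) near $b$ if $\int^b\frac{dt}{p_0(t)u_0(t)^2}=\infty$. $\tau_1-E$ is called nonoscillatory if one (equivalently, every) nontrivial solution of $(\tau_1-E)u=0$ has finitely many zeros in $(a,b)$, and oscillatory otherwise. *)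

(* Defs.v *)
From HB Require Import structures.
From mathcomp Require Import all_boot all_order all_algebra.
From mathcomp Require Import complex.
From mathcomp Require Import all_classical all_reals all_analysis.

Set Implicit Arguments.
Unset Strict Implicit.
Unset Printing Implicit Defensive.

Import Order.TTheory GRing.Theory Num.Theory.
Import numFieldNormedType.Exports.

Local Open Scope classical_set_scope.
Local Open Scope ring_scope.

(* Throughout, functions are total on R but only their values on (a, +oo)
   matter. The coefficients of a Sturm-Liouville expression are determined
   only up to Lebesgue null sets, hence the a.e. formulations below. *)

Section SturmLiouville.
Context {R : realType}.
Notation mu := (@lebesgue_measure R).

(* p_j^{-1}, q_j, r in L^1_loc(a, oo) and p_j, r > 0. *)
Definition coefficients (a : R) (p q r : R -> R) : Prop :=
  [/\ locally_integrable `]a, +oo[ (fun x => (p x)^-1),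
      locally_integrable `]a, +oo[ q,
      locally_integrable `]a, +oo[ r &
      {ae mu, forall x, a < x -> 0 < p x /\ 0 < r x}].

Definition integrable_near_left (a : R) (f : R -> R) : Prop :=
  exists2 c, a < c & mu.-integrable `]a, c[ (EFin \o f).

Definition regular_left (a : R) (p q r : R -> R) : Prop :=
  [/\ integrable_near_left a q,
      integrable_near_left a (fun x => (p x)^-1) &
      integrable_near_left a r].

(* f in AC_loc(a, oo), i.e. f is an indefinite integral of some
   g in L^1_loc(a, oo). *)
Definition loc_abs_cont (a : R) (f : R -> R) : Prop :=
  exists2 g : R -> R, locally_integrable `]a, +oo[ g &
    forall x y, a < x -> x <= y -> f y - f x = \int[mu]_(t in `[x, y]) g t.

(* u is in the (local) maximal domain of tau and tau u = f, where
   tau = r^{-1} (- d/dx p d/dx + q). The quasi-derivative p u' is only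
   required to coincide a.e. with an absolutely continuous function w. *)
Definition tau_eq (a : R) (p q r u f : R -> R) : Prop :=
  loc_abs_cont a u /\
  exists w : R -> R,
    [/\ loc_abs_cont a w,
        {ae mu, forall x, a < x -> w x = p x * derive1 u x} &
        {ae mu, forall x, a < x ->
           (r x)^-1 * (- derive1 w x + q x * u x) = f x}].

Definition solution (a : R) (p q r : R -> R) (E : R) (u : R -> R) : Prop :=
  tau_eq a p q r u (fun x => E * u x).

Definition complex_solution (a : R) (p q r : R -> R) (z : R[i])
    (u : R -> R[i]) : Prop :=
  tau_eq a p q r (fun x => complex.Re (u x)) (fun x => complex.Re (z * u x)) /\
  tau_eq a p q r (fun x => complex.Im (u x)) (fun x => complex.Im (z * u x)).

Definition L2_near_infty (a : R) (r : R -> R) (u : R -> R[i]) : Prop :=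
  exists2 c, a < c & mu.-integrable `]c, +oo[
    (fun x => ((complex.Re (u x) ^+ 2 + complex.Im (u x) ^+ 2) * r x)%:E).

(* By Weyl's alternative the condition does not depend on z. *)
Definition limit_point_infty (a : R) (p q r : R -> R) : Prop :=
  exists z : R[i], forall u v : R -> R[i],
    complex_solution a p q r z u -> L2_near_infty a r u ->
    complex_solution a p q r z v -> L2_near_infty a r v ->
    exists c d : R[i], (c, d) != (0, 0) /\
      forall x, a < x -> c * u x + d * v x = 0.

Definition minimal_positive_solution (a : R) (p q r : R -> R) (E : R)
    (u : R -> R) : Prop :=
  [/\ solution a p q r E u,
      forall x, a < x -> 0 < u x &
      forall c, a < c ->
        (\int[mu]_(t in `]c, +oo[) ((p t * u t ^+ 2)^-1)%:E = +oo)%E].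

Definition nonoscillatory (a : R) (p q r : R -> R) (E : R) : Prop :=
  exists u : R -> R,
    [/\ solution a p q r E u,
        exists2 x, a < x & u x != 0 &
        finite_set [set x | a < x /\ u x = 0]].

Definition oscillatory (a : R) (p q r : R -> R) (E : R) : Prop :=
  ~ nonoscillatory a p q r E.

(* The filter of "x -> +oo, outside a null set": the essential version of
   +oo, appropriate for asymptotics of functions determined only a.e. *)
Definition ess_pinfty : set_system R :=
  [set A | exists M : R, {ae mu, forall x, M < x -> A x}].

Global Instance ess_pinfty_filter : Filter ess_pinfty.
Proof.
have aeF := ae_filter_ringOfSetsType mu.
split.
- by exists 0; apply: aeW.
- move=> A B [M hM] [N hN]; exists (Num.max M N).
  apply: (@filterS2 _ _ aeF _ _ _ _ hM hN) => x hA hB.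
  by rewrite gt_max => /andP[/hA ? /hB ?].
- by move=> A B AB [M hM]; exists M; apply: (@filterS _ _ aeF _ _ _ hM) => x hA /hA /AB.
Qed.

Canonical ess_pinfty_filterType := FilterType ess_pinfty ess_pinfty_filter.

Definition Delta_p (p0 p1 : R -> R) (x : R) : R := (p0 x)^-1 - (p1 x)^-1.

Definition Delta_q (q0 q1 : R -> R) (x : R) : R := q1 x - q0 x.

(* d'Alembert's second solution v_0. *)
Definition second_solution (a : R) (p u : R -> R) (x : R) : R :=
  u x * \int[mu]_(t in `]a, x]) (p t * u t ^+ 2)^-1.

End SturmLiouville.

(* Main.v *)
Require Import Defs.
From HB Require Import structures.
From mathcomp Require Import all_boot all_order all_algebra.
From mathcomp Require Import complex.
From mathcomp Require Import all_classical all_reals all_analysis.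
From mathcomp Require Import measurable_realfun.
From mathcomp Require Import ring lra.

Set Implicit Arguments.
Unset Strict Implicit.
Unset Printing Implicit Defensive.

Import Order.TTheory GRing.Theory Num.Theory.
Import numFieldNormedType.Exports.

Local Open Scope classical_set_scope.
Local Open Scope ring_scope.

(**
Let w0 = p0 u0' and let S be the primitive of 1 / (p0 u0^2) that vanishes at
a, so that v0 = u0 S, rho = S'/S = (log S)', and S tends to infinity because u0
is minimal. Given a solution u1 of the perturbed equation with quasi-derivative
w1, put, wherever u1 does not vanish,
    phi = S u0^2 w1 / u1 - S u0 w0.
This is S times the Wronskian of u0 and u1, divided by u1 / u0; when p1 = p0 it
is the logarithmic derivative of u1 / u0 with respect to log S. The product and
quotient rules give
    phi' = rho (phi - phi^2 + Q + 2 c phi + d phi^2),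
where Q is the expression that is averaged in the criterion, and where
c = p0 v0 p0 u0' (1/p0 - 1/p1) and d = p0 (1/p0 - 1/p1) tend to zero. Thus the
second order equation has become a Riccati equation on the scale log S, for
which the constant 1/4 is the maximum of phi - phi^2.

The bounded function Q enters only through its averages: as rho is nearly
constant on a window [x, x + l], the integral of rho Q over the window is
rho(x) times the integral of Q, up to a small multiple of the integral of rho
(averaged_le). This holds first for almost every x, hence, both sides being
continuous, for every large x (window_ge0_everywhere).

If the averages stay below -1/4 - e, then phi loses at least a fixed multiple
of the integral of rho over each window, and the integral of rho diverges
(log_divergence), so phi tends to minus infinity. Far below zero the equation is
dominated by - rho phi^2, so 1 / phi grows at least as fast as half the
integral of rho and would have to reach 0 in finite time. So phi cannot exist
on a half-line: u1 keeps having zeros (riccati_oscillation).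

If the averages stay above -1/4 + e, a solution that starts with phi slightly
above 1/2 cannot get below 1/2: phi moves little over one window, since rho
tends to zero, so that at a first descent to 1/2 it would have spent a whole
window near 1/2, where phi - phi^2 is almost 1/4 and phi increases over the
window (riccati_trap). While phi is at least 1/2, the quotient u1 / u0 does not
decrease, so u1 has no further zero. A regular left endpoint leaves only
finitely many zeros before that (finite_zeros).

Absolutely continuous functions are handled as pairs of a function and a
density; product and quotient rules come from a continuous induction
(local_to_global). The solution of the second part is produced by Picard
iteration from the endpoint a (linear_system_exists).
*)

Ltac keep_inequalities := repeat match goal with
  | H : forall _, _ |- _ => clear H
  | H : prop_near1 _ _ |- _ => clear H
  | H : is_true (integrable _ _ _) |- _ => clear H
  | H : @eq (_ -> _) _ _ |- _ => clear H
  end.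
Ltac lin_arith := keep_inequalities; lra.
Ltac nonlin_arith := keep_inequalities; nra.

(** * Continuous induction and crossings *)

Section Calculus.
Context {R : realType}.
Implicit Types (a b x y : R) (f F : R -> R).

(** Continuous induction: the supremum of the points y with P a y is itself
such a point, by the hypothesis at the supremum, which also excludes that it
lies below b. It replaces subdivisions into small intervals. *)
Lemma local_to_global (P : R -> R -> Prop) a b : a <= b ->
  (forall x y z, a <= x -> x <= y -> y <= z -> z <= b ->
     P x y -> P y z -> P x z) ->
  (forall c, a <= c -> c <= b -> exists2 d : R, 0 < d &
     forall x y, a <= x -> x <= c -> c <= y -> y <= b ->
       c - x < d -> y - c < d -> P x y) ->
  P a b.
Proof.
move=> ab trP locP.
pose A := [set x | [/\ a <= x, x <= b & P a x]].
have Aa : A a.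
  split => //; have [d d0 h] := locP a (lexx _) ab.
  by apply: h => //; rewrite subrr.
have supA : has_sup A by split; [exists a | exists b => x []].
have as_ : a <= sup A by apply: ub_le_sup => //; case: supA.
have sb : sup A <= b by apply: ge_sup; [exists a | move=> x []].
have [d d0 hd] := locP _ as_ sb.
have [x [ax xb Pax] sx] := sup_adherent d0 supA.
have xs : x <= sup A by apply: ub_le_sup; [case: supA | split].
have Py y : sup A <= y -> y <= b -> y - sup A < d -> P a y.
  move=> sy yb yd; apply: (trP a x y) => //; first exact: le_trans sy.
  by apply: hd => //; lin_arith.
have [bs|bs] := ltP (b - sup A) d; first exact: Py.
have /ub_le_sup : A (sup A + d / 2).
  by split; [lin_arith|lin_arith|apply: Py; lin_arith].
by move=> /(_ supA.2); lin_arith.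
Qed.

(** Phrased with epsilon and delta because that is what the hypothesis of
local_to_global asks for. *)
Definition cont_on a b f := forall c, a <= c -> c <= b -> forall e : R, 0 < e ->
  exists2 d : R, 0 < d & forall x, a <= x -> x <= b -> `|x - c| < d ->
    `|f x - f c| < e.

(** The infimum of the points where f is at most v. *)
Lemma first_hit f a b (v : R) : a <= b -> cont_on a b f ->
  v <= f a -> f b <= v ->
  exists t, [/\ a <= t, t <= b, f t = v & forall x, a <= x -> x <= t -> v <= f x].
Proof.
move=> ab cf fa fb.
pose A := [set x | [/\ a <= x, x <= b & f x <= v]].
have Ab : A b by split.
have infA : has_inf A by split; [exists b | exists a => x []].
set t := inf A.
have at_ : a <= t by apply: lb_le_inf; [exists b | move=> x []].
have tb : t <= b by apply: ge_inf => //; case: infA.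
have before x : a <= x -> x < t -> v < f x.
  move=> ax xt; rewrite ltNge; apply/negP => fxv.
  have : t <= x by apply: ge_inf; [case: infA | split => //; lin_arith].
  by rewrite leNgt xt.
have ftv : f t <= v.
  rewrite leNgt; apply/negP => vft.
  have [d d0 hd] := cf t at_ tb (f t - v) ltac:(lin_arith).
  have [x [ax xb fxv] xt] := inf_adherent d0 infA.
  have tx : t <= x by apply: ge_inf; [case: infA | split].
  have := hd x ax xb; rewrite ger0_norm; last lin_arith.
  by move=> /(_ ltac:(rewrite -/t in xt; lin_arith)); rewrite ltr_norml; lin_arith.
have vft : v <= f t.
  move: at_; rewrite le_eqVlt => /orP[/eqP <- //|lat].
  rewrite leNgt; apply/negP => ftv'.
  have [d d0 hd] := cf t (ltW lat) tb (v - f t) ltac:(lin_arith).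
  pose x := Num.max a (t - d / 2).
  have ax : a <= x by rewrite le_max lexx.
  have xt : x < t by rewrite gt_max lat; lin_arith.
  have xd : t - d / 2 <= x by rewrite le_max lexx orbT.
  have := hd x ax ltac:(lin_arith); rewrite ltr0_norm; last lin_arith.
  move=> /(_ ltac:(lin_arith)); rewrite ltr_norml.
  by have := before x ax xt; lin_arith.
exists t; split => //; first lin_arith.
move=> x ax; rewrite le_eqVlt => /orP[/eqP -> //|xt].
exact/ltW/before.
Qed.

(** The first passage through v, preceded by the last passage through u;
the latter is a first passage of the reflected function x |-> - f (- x). In
between, f lies in the band from v to u, so a differential inequality that is
only known on this band can be integrated there. *)
Lemma down_crossing f a b (u v : R) : a <= b -> cont_on a b f ->
  u <= f a -> f b <= v -> v <= u ->
  exists s t, [/\ a <= s, s <= t & t <= b] /\ [/\ f s = u, f t = v,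
    forall x, a <= x -> x <= t -> v <= f x &
    forall x, s <= x -> x <= t -> f x <= u].
Proof.
move=> ab cf fa fb vu.
have [t [at_ tb ft ht]] := first_hit ab cf (le_trans vu fa) fb.
have cg : cont_on (- t) (- a) (fun x => - f (- x)).
  move=> c c1 c2 e e0.
  have [d d0 hd] := cf (- c) ltac:(lin_arith) ltac:(lin_arith) e e0.
  exists d => // x x1 x2 xc.
  rewrite -opprD normrN; apply: hd; [lin_arith|lin_arith|].
  by rewrite -opprD normrN.
have [s [s1 s2 fs hs]] : exists s, [/\ - t <= s, s <= - a, - f (- s) = - u &
    forall x, - t <= x -> x <= s -> - u <= - f (- x)].
  by apply: first_hit cg _ _; rewrite ?opprK ?lerN2 ?ft.
exists (- s), t; split; first by split; lin_arith.
split => //; first lin_arith.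
by move=> x sx xt; have := hs (- x) ltac:(lin_arith) ltac:(lin_arith); rewrite opprK; lin_arith.
Qed.

End Calculus.

(** * Integrals over compact intervals *)

Section Integrals.
Context {R : realType}.
Notation mu := (@lebesgue_measure R).
Implicit Types (a b x y : R) (f g F G : R -> R).

Definition itg a b f := mu.-integrable `[a, b] (EFin \o f).
Definition integ a b f := \int[mu]_(t in `[a, b]) f t.

Lemma itgS a b x y f : a <= x -> y <= b -> itg a b f -> itg x y f.
Proof.
move=> ax yb; apply: integrableS => //.
by apply: subset_itv; rewrite bnd_simp.
Qed.

Lemma itg_meas a b f : itg a b f -> measurable_fun `[a, b] f.
Proof. by move=> /integrableP[/measurable_EFinP]. Qed.

Lemma itgD a b f g : itg a b f -> itg a b g -> itg a b (fun t => f t + g t).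
Proof. by move=> h1 h2; exact: (@integrableD _ _ _ mu _ (measurable_itv `[a, b]) _ _ h1 h2). Qed.

Lemma itgN a b f : itg a b f -> itg a b (fun t => - f t).
Proof.
move=> h; rewrite /itg (_ : EFin \o _ = -%E \o (EFin \o f))//.
exact: integrableN.
Qed.

Lemma itgB a b f g : itg a b f -> itg a b g -> itg a b (fun t => f t - g t).
Proof. by move=> ? ?; apply: itgD => //; apply: itgN. Qed.

Lemma itgZ a b (k : R) f : itg a b f -> itg a b (fun t => k * f t).
Proof. by move=> h; exact: (@integrableZl _ _ _ mu _ (measurable_itv `[a, b]) k _ h). Qed.

Lemma itg_norm a b f : itg a b f -> itg a b (fun t => `|f t|).
Proof. by move=> ?; apply: integrable_norm. Qed.

Lemma itg_cst a b (k : R) : itg a b (fun=> k).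
Proof.
apply: measurable_bounded_integrable => //.
  by rewrite /= lebesgue_measure_itv; case: ifP => _; rewrite ?ltry// -EFinB ltry.
by exists `|k|; split => // B kB x _ /=; apply: ltW.
Qed.

Lemma eq_itg a b f g : (forall t, a <= t -> t <= b -> f t = g t) ->
  itg a b f -> itg a b g.
Proof.
move=> fg; apply: eq_integrable => // t;  rewrite inE/= in_itv/= => /andP[at_ tb].
by rewrite fg.
Qed.

Lemma integD a b f g : itg a b f -> itg a b g ->
  integ a b (fun t => f t + g t) = integ a b f + integ a b g.
Proof. exact: RintegralD. Qed.

Lemma integB a b f g : itg a b f -> itg a b g ->
  integ a b (fun t => f t - g t) = integ a b f - integ a b g.
Proof. exact: RintegralB. Qed.

Lemma integZ a b (k : R) f : itg a b f ->
  integ a b (fun t => k * f t) = k * integ a b f.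
Proof. by move=> ?; apply: RintegralZl. Qed.

Lemma integ_cst a b (k : R) : a <= b -> integ a b (fun=> k) = k * (b - a).
Proof.
move=> ab; rewrite /integ Rintegral_cst//= lebesgue_measure_itv/= lte_fin.
by case: ltP => //= ba; congr (_ * _); lin_arith.
Qed.

Lemma eq_integ a b f g : (forall t, a <= t -> t <= b -> f t = g t) ->
  integ a b f = integ a b g.
Proof.
move=> fg; apply: eq_Rintegral => t; rewrite inE/= in_itv/= => /andP[at_ tb].
by rewrite fg.
Qed.

Lemma integ_pt a f : integ a a f = 0.
Proof. by rewrite /integ set_itv1 Rintegral_set1. Qed.

Lemma integ_split a b c f : a <= b -> b <= c -> itg a c f ->
  integ a c f = integ a b f + integ b c f.
Proof.
move=> ab bc fi; rewrite /integ.
have := @Rintegral_itvB R f (BLeft a) (BRight c) b fi.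
rewrite !bnd_simp => /(_ ab bc) h.
rewrite -(@Rintegral_itv_obnd_cbnd R b (BRight c)) -?h; first by rewrite subrKC.
apply: integrableS fi => //; apply: subset_itv; rewrite bnd_simp//.
Qed.

Lemma integ_ge0 a b f : (forall t, a <= t -> t <= b -> 0 <= f t) ->
  0 <= integ a b f.
Proof.
by move=> f0; apply: Rintegral_ge0 => t /=; rewrite in_itv/= => /andP[/f0]; apply.
Qed.

Lemma integ_ge0_ae a b f : itg a b f ->
  {ae mu, forall t, a <= t -> t <= b -> 0 <= f t} -> 0 <= integ a b f.
Proof.
move=> fi f0.
suff -> : integ a b f = integ a b (fun t => `|f t|) by apply: integ_ge0.
rewrite /integ /Rintegral; congr fine; apply: ae_eq_integral => //.
- by case/integrableP: fi.
- by case/integrableP: (itg_norm fi).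
- have aeF := ae_filter_ringOfSetsType mu.
  apply: (@filterS _ _ aeF _ _ _ f0) => t h /=.
  by rewrite in_itv/= => /andP[at_ tb]; rewrite ger0_norm// h.
Qed.

Lemma le_integ_ae a b f g : itg a b f -> itg a b g ->
  {ae mu, forall t, a <= t -> t <= b -> f t <= g t} ->
  integ a b f <= integ a b g.
Proof.
move=> fi gi fg; rewrite -subr_ge0 -integB//.
apply: integ_ge0_ae; first exact: itgB.
have aeF := ae_filter_ringOfSetsType mu.
by apply: (@filterS _ _ aeF _ _ _ fg) => t h at_ tb; rewrite subr_ge0 h.
Qed.

Lemma le_integ a b f g : itg a b f -> itg a b g ->
  (forall t, a <= t -> t <= b -> f t <= g t) ->
  integ a b f <= integ a b g.
Proof. by move=> fi gi fg; apply: le_integ_ae => //; apply: aeW. Qed.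

Lemma integ_norm a b f : itg a b f -> `|integ a b f| <= integ a b (fun t => `|f t|).
Proof. by move=> ?; apply: le_normr_Rintegral. Qed.

Lemma integ_gt0_ae a b f : a < b -> itg a b f ->
  {ae mu, forall t, a <= t -> t <= b -> 0 < f t} -> 0 < integ a b f.
Proof.
move=> ab fi f0.
have aeF := ae_filter_ringOfSetsType mu.
have ge0 : {ae mu, forall t, a <= t -> t <= b -> 0 <= f t}.
  by apply: (@filterS _ _ aeF _ _ _ f0) => t h at_ tb; apply/ltW/h.
rewrite lt_neqAle integ_ge0_ae// andbT eq_sym; apply/negP => /eqP I0.
have : (\int[mu]_(t in `[a, b]) `|(EFin \o f) t| = 0)%E.
  have := integ_ge0_ae fi ge0.
  transitivity (\int[mu]_(t in `[a, b]) (f t)%:E)%E; last first.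
    by rewrite -[LHS]fineK ?[fine _]I0//; apply: integrable_fin_num.
  apply: ae_eq_integral => //.
  - by case/integrableP: (itg_norm fi).
  - by case/integrableP: fi.
  - apply: (@filterS _ _ aeF _ _ _ ge0) => t h /=.
    by rewrite in_itv/= => /andP[at_ tb]; rewrite ger0_norm// h.
move=> /(ae_eq_integral_abs mu (measurable_itv _)).
move=> /(_ ltac:(by case/integrableP: fi)) fz.
have : {ae mu, forall t, ~ (`[a, b]%classic t)}.
  apply: (@filterS2 _ _ aeF _ _ _ _ f0 fz) => t h1 h2 h3.
  have := h2 h3; move: h3 => /=; rewrite in_itv/= => /andP[at_ tb] [] ft.
  by have := h1 at_ tb; rewrite ft ltxx.
move=> [N [mN N0 sN]].
have : (mu `[a, b]%classic <= mu N)%E.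
  by apply: le_measure; rewrite ?inE//; apply: subset_trans sN => t h /=; apply.
rewrite N0 lebesgue_measure_itv/= lte_fin ab -EFinD lee_fin; lin_arith.
Qed.

(** Multipliers that preserve integrability. *)
Definition bmeas a b f := measurable_fun `[a, b] f /\
  exists B, forall t, a <= t -> t <= b -> `|f t| <= B.

Lemma itgM a b f g : bmeas a b f -> itg a b g -> itg a b (fun t => f t * g t).
Proof.
move=> [mf [B hB]] gi.
refine (@integrableMr _ _ _ mu _ (measurable_itv `[a, b]) f (EFin \o g) mf _ gi).
exists B; split; first by rewrite num_real.
move=> C BC t /=; rewrite in_itv/= => /andP[at_ tb].
exact: le_trans (hB t at_ tb) (ltW BC).
Qed.

Lemma bmeasM a b f g : bmeas a b f -> bmeas a b g -> bmeas a b (fun t => f t * g t).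
Proof.
move=> [mf [B hB]] [mg [C hC]]; split; first exact: measurable_funM.
exists (B * C) => t at_ tb; rewrite normrM.
by apply: ler_pM; rewrite ?normr_ge0 ?hB ?hC.
Qed.

Lemma bmeas_sub a b x y f : a <= x -> y <= b -> bmeas a b f -> bmeas x y f.
Proof.
move=> ax yb [mf [B hB]]; split.
  by apply: measurable_funS mf => //; apply: subset_itv; rewrite bnd_simp.
by exists B => t xt ty; apply: hB; lin_arith.
Qed.

Lemma measurable_invr (D : set R) f : measurable_fun D f ->
  measurable_fun D (fun t => (f t)^-1).
Proof.
move=> mf; apply: (measurableT_comp _ mf) => {mf}.
have -> : [set: R] = `]-oo, 0[ `|` (`]0, +oo[ `|` [set 0]).
  apply/seteqP; split => // x _; have [x0|x0|->] := ltgtP x 0.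
  - by left; rewrite /= in_itv.
  - by right; left; rewrite /= in_itv/= x0.
  - by right; right.
apply/measurable_funU => //; first exact: measurableU.
split; last (apply/measurable_funU => //; split; last exact: measurable_fun_set1).
- apply: open_continuous_measurable_fun; first exact: interval_open.
  by move=> x; rewrite inE/= in_itv/= => x0; apply: inv_continuous; rewrite lt_eqF.
- apply: open_continuous_measurable_fun; first exact: interval_open.
  by move=> x; rewrite inE/= in_itv/= andbT => x0; apply: inv_continuous; rewrite gt_eqF.
Qed.

Lemma within_cont_on a b f : {within `[a, b], continuous f} -> cont_on a b f.
Proof.
move=> cf c ac cb e e0.
have cab : `[a, b]%classic c by rewrite /= in_itv/= ac cb.
have := cf c; rewrite /continuous_at => /cvgrPdist_lt /(_ e e0).
rewrite /prop_near1 /nbhs/= -nbhs_subspace_in// => -[d /= d0 hd].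
exists d => // x ax xb xc; rewrite distrC; apply: hd => /=.
  by rewrite distrC.
by rewrite in_itv/= ax xb.
Qed.

End Integrals.

(** * Absolutely continuous functions and their densities *)

Section Primitives.
Context {R : realType}.
Notation mu := (@lebesgue_measure R).
Implicit Types (a b x y : R) (f g F G : R -> R).

(** Absolute continuity with the density made explicit, so that the rules of
calculus become rules on densities. *)
Definition primitive a b F f := itg a b f /\
  forall x y, a <= x -> x <= y -> y <= b -> F y - F x = integ x y f.

Lemma primitiveS a b x y F f : a <= x -> y <= b ->
  primitive a b F f -> primitive x y F f.
Proof.
move=> ax yb [fi hF]; split; first exact: itgS fi.
by move=> s t xs st ty; apply: hF => //; lin_arith.
Qed.

Lemma primitive_within a b F f : a <= b -> primitive a b F f ->
  {within `[a, b], continuous F}.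
Proof.
move=> ab [fi hF].
have : {within `[a, b], continuous (fun x => F a + integ a x f)}.
  move=> x; apply: cvgD; first exact: cvg_cst.
  exact: (parameterized_integral_continuous ab fi).
apply: subspace_eq_continuous => x.
rewrite inE/= in_itv/= => /andP[ax xb].
by rewrite /from_subspace -hF// subrKC.
Qed.

Lemma primitive_cont a b F f : primitive a b F f -> cont_on a b F.
Proof.
move=> pF c ac cb; apply: (within_cont_on (a := a) (b := b)) => //.
exact: (primitive_within (le_trans ac cb) pF).
Qed.

Lemma primitive_bmeas a b F f : primitive a b F f -> bmeas a b F.
Proof.
move=> pF; split.
  have [ab|ba] := leP a b; last first.
    by rewrite set_itv_ge ?bnd_simp -?ltNge//; exact: measurable_fun_set0.
  apply: subspace_continuous_measurable_fun => //.
  exact: primitive_within pF.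
case: pF => fi hF.
exists (`|F a| + integ a b (fun t => `|f t|)) => x ax xb.
rewrite -[F x](subrK (F a)) addrC.
apply: (le_trans (ler_normD _ _)); rewrite lerD2l hF//.
apply: (le_trans (integ_norm _)); first exact: itgS fi.
rewrite [leRHS](integ_split ax xb); last exact: itg_norm.
by rewrite lerDl; apply: integ_ge0.
Qed.

Lemma primitive_integ a b f (k : R) : itg a b f ->
  primitive a b (fun x => k + integ a x f) f.
Proof.
move=> fi; split => // x y ax xy yb.
rewrite (integ_split ax xy); first by ring.
exact: itgS fi.
Qed.

Lemma primitive_cst a b (k : R) : primitive a b (fun=> k) (fun=> 0).
Proof.
split; first exact: itg_cst.
by move=> x y _ xy _; rewrite integ_cst// mul0r subrr.
Qed.

Lemma primitiveD a b F f G g : primitive a b F f -> primitive a b G g ->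
  primitive a b (fun x => F x + G x) (fun x => f x + g x).
Proof.
move=> [fi hF] [gi hG]; split; first exact: itgD.
move=> x y ax xy yb; rewrite integD; [|exact: itgS fi|exact: itgS gi].
by rewrite -hF// -hG//; ring.
Qed.

Lemma primitiveZ a b (k : R) F f : primitive a b F f ->
  primitive a b (fun x => k * F x) (fun x => k * f x).
Proof.
move=> [fi hF]; split; first exact: itgZ.
move=> x y ax xy yb; rewrite integZ; last exact: itgS fi.
by rewrite -hF//; ring.
Qed.

Lemma primitiveN a b F f : primitive a b F f ->
  primitive a b (fun x => - F x) (fun x => - f x).
Proof.
move=> [fi hF]; split; first exact: itgN.
move=> x y ax xy yb.
rewrite (@eq_integ _ x y _ (fun t => -1 * f t)); last by move=> *; ring.
by rewrite integZ -?hF//; [ring | exact: itgS fi].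
Qed.

Lemma primitiveB a b F f G g : primitive a b F f -> primitive a b G g ->
  primitive a b (fun x => F x - G x) (fun x => f x - g x).
Proof. by move=> pF pG; apply: primitiveD => //; apply: primitiveN. Qed.

Lemma eq_primitive a b F G f g :
  (forall x, a <= x -> x <= b -> F x = G x) ->
  (forall x, a <= x -> x <= b -> f x = g x) ->
  primitive a b F f -> primitive a b G g.
Proof.
move=> FG fg [fi hF]; split; first exact: eq_itg fi.
move=> x y ax xy yb; rewrite -!FG; try lin_arith.
rewrite hF//; apply: eq_integ => t xt ty; apply: fg; lin_arith.
Qed.

Lemma primitive_ae a b F f g : primitive a b F f -> itg a b g ->
  {ae mu, forall x, a <= x -> x <= b -> f x = g x} -> primitive a b F g.
Proof.
move=> [fi hF] gi fg; split => // x y ax xy yb.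
have aeF := ae_filter_ringOfSetsType mu.
rewrite hF//; apply/eqP; rewrite eq_le.
by apply/andP; split; apply: le_integ_ae; try exact: (itgS _ _ fi);
  try exact: (itgS _ _ gi); apply: (@filterS _ _ aeF _ _ _ fg) => t h xt ty;
  rewrite h//; lin_arith.
Qed.

(** Both sides of the local estimate are controlled by additive functions of
intervals, so the estimate globalizes; then e is arbitrary. *)
Lemma primitive_of_local a b F f g : itg a b f -> itg a b g ->
  (forall e : R, 0 < e -> forall c, a <= c -> c <= b -> exists2 d : R, 0 < d &
     forall x y, a <= x -> x <= c -> c <= y -> y <= b ->
       c - x < d -> y - c < d ->
       `|F y - F x - integ x y f| <= e * integ x y g) ->
  primitive a b F f.
Proof.
move=> fi gi loc; split => // x y ax xy yb.
suff h e : 0 < e -> `|F y - F x - integ x y f| <= e * integ x y g.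
  apply/eqP; rewrite -subr_eq0 -normr_le0 leNgt; apply/negP => D0.
  set D := `|_| in D0 h; set K := integ x y g in h.
  have [K0|K0] := leP K 0.
    have := h 1 ltr01; lin_arith.
  have := h (D / (2 * K)) ltac:(by rewrite divr_gt0// mulr_gt0).
  have -> : D / (2 * K) * K = D / 2 by field; rewrite gt_eqF.
  lin_arith.
move=> e0; apply: (@local_to_global _ (fun s t =>
  `|F t - F s - integ s t f| <= e * integ s t g)) => //.
- move=> s t u xs st tu uy Pst Ptu.
  have fsu : itg s u f by apply: itgS fi; lin_arith.
  have gsu : itg s u g by apply: itgS gi; lin_arith.
  rewrite (integ_split st tu fsu) (integ_split st tu gsu) mulrDr.
  apply: le_trans (lerD Pst Ptu); apply: le_trans (ler_normD _ _).
  by rewrite le_eqVlt; apply/orP; left; apply/eqP; congr (`|_|); ring.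
- move=> c xc cy; have [d d0 hd] := loc e e0 c ltac:(lin_arith) ltac:(lin_arith).
  by exists d => // s t *; apply: hd => //; lin_arith.
Qed.

(** Over [x, y] the error in the product rule is the integral of
f (G y - G) + (F x - F) g, which is small against the integral of |f| + |g|
when x and y are close, by continuity of F and G. *)
Lemma primitiveM a b F f G g : primitive a b F f -> primitive a b G g ->
  primitive a b (fun x => F x * G x) (fun x => G x * f x + F x * g x).
Proof.
move=> pF pG; have bF := primitive_bmeas pF; have bG := primitive_bmeas pG.
have cF := primitive_cont pF; have cG := primitive_cont pG.
case: pF => fi hF; case: pG => gi hG.
apply: (@primitive_of_local _ _ _ _ (fun t => `|f t| + `|g t|)).
- by apply: itgD; apply: itgM.
- by apply: itgD; apply: itg_norm.
move=> e e0 c ac cb.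
have [d d0 hd] := cF c ac cb (e / 2) ltac:(lin_arith).
have [d' d'0 hd'] := cG c ac cb (e / 2) ltac:(lin_arith).
exists (Num.min d d'); first by rewrite lt_min d0.
move=> x y ax xc cy yb; rewrite !lt_min => /andP[x1 x2] /andP[y1 y2].
have fxy : itg x y f by exact: itgS fi.
have gxy : itg x y g by exact: itgS gi.
have bFxy : bmeas x y F by exact: bmeas_sub bF.
have bGxy : bmeas x y G by exact: bmeas_sub bG.
have bC k : bmeas x y (fun=> k).
  by split; [exact: measurable_cst | exists `|k|].
have iGf : itg x y (fun t => G t * f t) by exact: itgM.
have iFg : itg x y (fun t => F t * g t) by exact: itgM.
have xy : x <= y by lin_arith.
have -> : F y * G y - F x * G x - integ x y (fun t => G t * f t + F t * g t) =
    integ x y (fun t => (G y * f t - G t * f t) + (F x * g t - F t * g t)).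
  have Gyf : itg x y (fun t => G y * f t) by exact: itgZ.
  have Fxg : itg x y (fun t => F x * g t) by exact: itgZ.
  rewrite (integD iGf iFg) (integD (itgB Gyf iGf) (itgB Fxg iFg)).
  rewrite (integB Gyf iGf) (integB Fxg iFg) (integZ _ fxy) (integZ _ gxy).
  by rewrite -hF// -hG//; ring.
have ii : itg x y (fun t => G y * f t - G t * f t + (F x * g t - F t * g t)).
  by apply: itgD; apply: itgB => //; apply: itgZ.
apply: (le_trans (integ_norm ii)).
rewrite -integZ; last by apply: itgD; apply: itg_norm.
apply: le_integ.
- exact: itg_norm.
- by apply: itgZ; apply: itgD; apply: itg_norm.
move=> t xt ty.
rewrite -!mulrBl mulrDr; apply: (le_trans (ler_normD _ _)).
have close (H : R -> R) (r : R) : (forall x, a <= x -> x <= b -> `|x - c| < r ->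
     `|H x - H c| < e / 2) -> c - x < r -> y - c < r ->
     forall s t, x <= s -> s <= y -> x <= t -> t <= y -> `|H s - H t| <= e.
  move=> hH xr yr s u xs sy xu uy.
  have k1 : `|H s - H c| < e / 2.
    by apply: hH; [lin_arith|lin_arith|rewrite ltr_norml; apply/andP; split; lin_arith].
  have k2 : `|H u - H c| < e / 2.
    by apply: hH; [lin_arith|lin_arith|rewrite ltr_norml; apply/andP; split; lin_arith].
  move: k1 k2; rewrite !ltr_norml ler_norml => /andP[? ?] /andP[? ?].
  by apply/andP; split; lin_arith.
rewrite !normrM; apply: lerD; apply: ler_wpM2r => //.
- exact: (close G d').
- exact: (close F d).
Qed.

Lemma primitive_inv_bounded a b F f : a <= b -> primitive a b F f ->
  (forall x, a <= x -> x <= b -> F x != 0) ->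
  exists B, forall x, a <= x -> x <= b -> `|(F x)^-1| <= B.
Proof.
move=> ab pF F0.
have cF : {within `[a, b], continuous (fun x => `|F x|)}.
  by move=> x; apply: cvg_norm; exact: (primitive_within ab pF).
have [c cab hc] := EVT_min ab cF.
have Fc : 0 < `|F c|.
  by move: cab; rewrite in_itv/= => /andP[? ?]; rewrite normr_gt0 F0.
exists (`|F c|^-1) => x ax xb; have Fx : 0 < `|F x| by rewrite normr_gt0 F0.
by rewrite normfV lef_pV2//; apply: hc; rewrite in_itv/= ax.
Qed.

(** Over [x, y] the error is the integral of f times
F^-2 - (F x)^-1 (F y)^-1, and F^-1 is bounded on [a, b]. *)
Lemma primitiveV a b F f : a <= b -> primitive a b F f ->
  (forall x, a <= x -> x <= b -> F x != 0) ->
  primitive a b (fun x => (F x)^-1) (fun x => - ((F x)^-1 * (F x)^-1 * f x)).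
Proof.
move=> ab pF F0.
have [B hB] := primitive_inv_bounded ab pF F0.
have bF := primitive_bmeas pF.
have bV : bmeas a b (fun x => (F x)^-1).
  by split; [apply: measurable_invr; case: bF | exists B].
have cF := primitive_cont pF; case: (pF) => fi hF.
have B0 : 0 <= B by apply: (le_trans _ (hB a _ _)).
pose A := 2 * B * B * B + 1.
have A0 : 0 < A by rewrite ltr_pwDr// !mulr_ge0.
have iVf : itg a b (fun x => (F x)^-1 * (F x)^-1 * f x).
  by apply: itgM => //; apply: bmeasM.
apply: (@primitive_of_local _ _ _ _ (fun t => `|f t|)).
- exact: itgN.
- exact: itg_norm.
move=> e e0 c ac cb.
have e'0 : 0 < e / A / 2 by rewrite !divr_gt0.
have [d d0 hd] := cF c ac cb _ e'0.
exists d => // x y ax xc cy yb xd yd.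
have xy : x <= y by lin_arith.
have Fx : F x != 0 by apply: F0; lin_arith.
have Fy : F y != 0 by apply: F0; lin_arith.
have fxy : itg x y f by exact: itgS fi.
have iVfxy : itg x y (fun x => (F x)^-1 * (F x)^-1 * f x) by exact: itgS iVf.
have -> : (F y)^-1 - (F x)^-1 -
    integ x y (fun x => - ((F x)^-1 * (F x)^-1 * f x)) =
    integ x y (fun t => (F t)^-1 * (F t)^-1 * f t - (F x)^-1 * (F y)^-1 * f t).
  rewrite integB ?integZ//; last exact: itgZ.
  rewrite (@eq_integ _ x y (fun x => - _)
    (fun t => -1 * ((F t)^-1 * (F t)^-1 * f t))); last by move=> *; ring.
  by rewrite integZ// -hF//; field; rewrite Fx Fy.
have ii : itg x y (fun t => (F t)^-1 * (F t)^-1 * f t - (F x)^-1 * (F y)^-1 * f t).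
  by apply: itgB => //; apply: itgZ.
apply: (le_trans (integ_norm ii)); rewrite -integZ; last exact: itg_norm.
apply: le_integ; [exact: itg_norm | by apply: itgZ; apply: itg_norm |].
move=> t xt ty; rewrite -mulrBl normrM; apply: ler_wpM2r => //.
have at_ : a <= t by lin_arith.
have tb : t <= b by lin_arith.
have close s u : x <= s -> s <= y -> x <= u -> u <= y ->
    `|(F s)^-1 - (F u)^-1| <= B * B * (e / A).
  move=> xs sy xu uy.
  have Fs : F s != 0 by apply: F0; lin_arith.
  have Fu : F u != 0 by apply: F0; lin_arith.
  have -> : (F s)^-1 - (F u)^-1 = (F s)^-1 * (F u)^-1 * (F u - F s).
    by field; rewrite Fs Fu.
  rewrite !normrM.
  have k1 : `|F s - F c| < e / A / 2.
    by apply: hd; [lin_arith|lin_arith|rewrite ltr_norml; apply/andP; split; lin_arith].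
  have k2 : `|F u - F c| < e / A / 2.
    by apply: hd; [lin_arith|lin_arith|rewrite ltr_norml; apply/andP; split; lin_arith].
  apply: ler_pM; [by rewrite mulr_ge0|by []| |].
    by apply: ler_pM => //; apply: hB; lin_arith.
  move: k1 k2; rewrite !ltr_norml ler_norml => /andP[? ?] /andP[? ?].
  by apply/andP; split; lin_arith.
have -> : (F t)^-1 * (F t)^-1 - (F x)^-1 * (F y)^-1 =
   (F t)^-1 * ((F t)^-1 - (F x)^-1) + (F x)^-1 * ((F t)^-1 - (F y)^-1) by ring.
apply: (le_trans (ler_normD _ _)); rewrite !normrM.
apply: (@le_trans _ _ (B * (B * B * (e / A)) + B * (B * B * (e / A)))).
  by apply: lerD; apply: ler_pM => //; first [apply: hB; lin_arith|apply: close; lin_arith].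
have -> : B * (B * B * (e / A)) + B * (B * B * (e / A)) =
  (A - 1) * (e / A) by rewrite /A; ring.
have -> : e = A * (e / A) by field; rewrite gt_eqF.
have -> : A * (e / A) / A = e / A by field; rewrite gt_eqF.
by apply: ler_wpM2r; [apply: divr_ge0; lin_arith | lin_arith].
Qed.

End Primitives.

(** * The perturbed Riccati equation *)

Section Riccati.
Context {R : realType}.
Notation mu := (@lebesgue_measure R).
Implicit Types (rho kap phi g : R -> R).

Let aeF := ae_filter_ringOfSetsType mu.

Lemma ae_itv_exists (a b : R) (P : R -> Prop) : a < b ->
  {ae mu, forall t, a <= t -> t <= b -> P t} ->
  exists t, [/\ a <= t, t <= b & P t].
Proof.
move=> ab hP; apply: contrapT => nP.
have : 0 < @integ R a b (fun=> -1).
  apply: integ_gt0_ae => //; first exact: itg_cst.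
  apply: (@filterS _ _ aeF _ _ _ hP) => t h at_ tb; case: nP.
  by exists t; split => //; apply: h.
rewrite integ_cst; lin_arith.
Qed.

Lemma integ_subset_le a b c d f : a <= c -> c <= d -> d <= b -> @itg R a b f ->
  {ae mu, forall t, a <= t -> t <= b -> 0 <= f t} ->
  integ c d f <= integ a b f.
Proof.
move=> ac cd db fi f0.
have acd : a <= d by lin_arith.
rewrite (integ_split acd db fi) (integ_split ac cd (itgS (lexx a) db fi)).
have h1 : 0 <= integ a c f.
  apply: integ_ge0_ae; first by apply: itgS fi; lin_arith.
  by apply: (@filterS _ _ aeF _ _ _ f0) => t h *; apply: h; lin_arith.
have h2 : 0 <= integ d b f.
  apply: integ_ge0_ae; first by apply: itgS fi; lin_arith.
  by apply: (@filterS _ _ aeF _ _ _ f0) => t h *; apply: h; lin_arith.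
lin_arith.
Qed.

(** The relative error d (1 + phi^2) absorbs the terms of the equation whose
coefficients tend to zero. *)
Definition perturbed_riccati (d : R) rho kap phi g (t : R) :=
  `|g t - (rho t * (phi t - phi t ^+ 2) + kap t)| <= d * (rho t * (1 + phi t ^+ 2)).

(** phi - phi^2 never exceeds 1/4. *)
Lemma riccati_upper (d e : R) rho kap phi g t : 0 <= d -> d <= 1/4 -> d <= e / 4 ->
  0 < rho t -> perturbed_riccati d rho kap phi g t ->
  g t <= (1/4 + e/2) * rho t + kap t.
Proof.
rewrite /perturbed_riccati => d0 d4 de r0; rewrite ler_norml => /andP[_ h].
have k : phi t - phi t ^+ 2 + d * (1 + phi t ^+ 2) <= 1/4 + e / 2.
  set s := phi t - 1/2; have -> : phi t = s + 1/2 by rewrite /s; ring.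
  suff : 0 <= (1 - d) * s ^+ 2 - d * s + 3/4 * d by nonlin_arith.
  have : 0 <= (s - 2/3 * d) ^+ 2 by rewrite sqr_ge0.
  have : 0 <= s ^+ 2 by rewrite sqr_ge0.
  nonlin_arith.
have := ler_wpM2l (ltW r0) k; lin_arith.
Qed.

(** Below - (C + 1), the term - phi^2 dominates all the others. *)
Lemma riccati_blowup (d C : R) rho kap phi g t : 0 <= d -> d <= 1/4 -> 0 <= C ->
  0 < rho t -> `|kap t| <= C * rho t -> perturbed_riccati d rho kap phi g t ->
  phi t <= - (C + 1) -> g t <= - (1/2) * (rho t * phi t ^+ 2).
Proof.
rewrite /perturbed_riccati => d0 d4 C0 r0.
rewrite !ler_norml => /andP[_ kC] /andP[_ h] pC.
have k : phi t - phi t ^+ 2 + C + d * (1 + phi t ^+ 2) <= - (1/2) * phi t ^+ 2.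
  have : 0 <= phi t ^+ 2 by rewrite sqr_ge0.
  nonlin_arith.
have := ler_wpM2l (ltW r0) k; lin_arith.
Qed.

(** phi - phi^2 is within h^2 of its maximum 1/4 on the band of width h
above 1/2. *)
Lemma riccati_lower (d e h : R) rho kap phi g t : 0 <= d -> 2 * d <= e / 4 ->
  0 <= h -> h <= 1/2 -> h ^+ 2 <= e / 4 ->
  0 < rho t -> perturbed_riccati d rho kap phi g t ->
  1/2 <= phi t -> phi t <= 1/2 + h -> (1/4 - e/2) * rho t + kap t <= g t.
Proof.
rewrite /perturbed_riccati => d0 de h0 h2 he r0.
rewrite ler_norml => /andP[hh _] p1 p2.
have k : 1/4 - e/2 <= phi t - phi t ^+ 2 - d * (1 + phi t ^+ 2).
  have : (phi t - 1/2) ^+ 2 <= h ^+ 2.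
    by rewrite ler_sqr ?nnegrE; lin_arith.
  have : phi t ^+ 2 <= 1 by rewrite expr_le1//; lin_arith.
  nonlin_arith.
have := ler_wpM2l (ltW r0) k; lin_arith.
Qed.

(** By riccati_upper, phi decreases on each window by a fixed fraction of the
integral of rho, so it gets below - 2 (C + 1); it cannot come back above
- (C + 1), where it is still decreasing; and from there on 1 / phi increases
at least half as fast as the integral of rho while remaining negative. *)
Lemma riccati_oscillation (M l C e d : R) rho kap phi g :
  0 < l -> 0 < e -> 0 <= C -> 0 <= d -> d <= 1/4 -> d <= e / 4 ->
  (forall x y, M < x -> itg x y rho) -> (forall x y, M < x -> itg x y kap) ->
  {ae mu, forall t, M < t -> 0 < rho t} ->
  {ae mu, forall t, M < t -> `|kap t| <= C * rho t} ->
  (forall x K, M < x -> exists2 y, x <= y & K <= integ x y rho) ->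
  (forall x, M < x ->
     integ x (x + l) kap <= (- (1/4) - e) * integ x (x + l) rho) ->
  (forall x y, M < x -> x <= y -> primitive x y phi g) ->
  {ae mu, forall t, M < t -> perturbed_riccati d rho kap phi g t} ->
  False.
Proof.
move=> l0 e0 C0 d0 d4 de irho ikap rho0 kapC div avg pphi hg.
have rho_ge0 x y : M < x -> {ae mu, forall t, x <= t -> t <= y -> 0 <= rho t}.
  move=> Mx; apply: (@filterS _ _ aeF _ _ _ rho0) => t h xt _; apply/ltW/h; lin_arith.
have window x : M < x -> phi (x + l) - phi x <= - (e / 2) * integ x (x + l) rho.
  move=> Mx; have xl : x <= x + l by lin_arith.
  have [gi ->] := pphi x (x + l) Mx xl; [|lin_arith|lin_arith|lin_arith].
  have hi : itg x (x + l) (fun t => (1/4 + e/2) * rho t + kap t).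
    by apply: itgD; [apply: itgZ; exact: irho | exact: ikap].
  apply: (@le_trans _ _ (integ x (x + l) (fun t => (1/4 + e/2) * rho t + kap t))).
    apply: le_integ_ae => //.
    apply: (@filterS2 _ _ aeF _ _ _ _ rho0 hg) => t h1 h2 xt _.
    by apply: riccati_upper (h1 _) (h2 _) => //; lin_arith.
  rewrite integD ?integZ; [|exact: irho|apply: itgZ; exact: irho|exact: ikap].
  by have := avg x Mx; lin_arith.
have windows x n : M < x ->
    phi (x + n%:R * l) - phi x <= - (e / 2) * integ x (x + n%:R * l) rho.
  move=> Mx; elim: n => [|n IH]; first by rewrite mul0r addr0 integ_pt; lin_arith.
  have nl : 0 <= n%:R * l by rewrite mulr_ge0 ?ler0n// ltW.
  have -> : x + n.+1%:R * l = x + n%:R * l + l by rewrite -natr1; ring.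
  rewrite (@integ_split _ _ (x + n%:R * l)); [|lin_arith|lin_arith|exact: irho].
  by have := window (x + n%:R * l) ltac:(lin_arith); lin_arith.
(* K is the threshold of riccati_blowup; going down to - 2 K leaves a band in
   which phi is seen to decrease *)
pose K := C + 1.
have [z Mz phiz] : exists2 z, M < z & phi z <= - (2 * K).
  pose x := M + 1; have Mx : M < x by rewrite /x; lin_arith.
  have [y xy hy] := div x ((phi x + 2 * K) / (e / 2)) Mx.
  pose n := (Num.truncn ((y - x) / l)).+1.
  have yn : y <= x + n%:R * l.
    have : (y - x) / l < n%:R by exact: truncnS_gt.
    by rewrite ltr_pdivrMr//; lin_arith.
  exists (x + n%:R * l); first lin_arith.
  have := windows x n Mx.
  have : integ x y rho <= integ x (x + n%:R * l) rho.
    apply: integ_subset_le => //; first exact: irho.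
    exact: rho_ge0.
  move: hy; rewrite ler_pdivrMr; last lin_arith.
  nonlin_arith.
have blow x y : M < x -> x <= y -> (forall t, x <= t -> t <= y -> phi t <= - K) ->
    {ae mu, forall t, x <= t -> t <= y -> g t <= - (1/2) * (rho t * phi t ^+ 2)}.
  move=> Mx xy hphi.
  have h3 := @filterI _ _ aeF _ _ rho0 hg.
  apply: (@filterS2 _ _ aeF _ _ _ _ kapC h3) => t h1 [h2 h4] xt ty.
  have Mt : M < t by lin_arith.
  by apply: riccati_blowup (h2 Mt) (h1 Mt) (h4 Mt) _ => //; apply: hphi.
have stay x : z <= x -> phi x <= - K.
  move=> zx; rewrite leNgt; apply/negP => Kx.
  have pz := primitiveN (pphi z x Mz zx).
  have [| | |s [t [[zs st tx] [ps pt lo _]]]] :=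
    @down_crossing _ _ z x (2 * K) K zx (primitive_cont pz); rewrite ?/K; try by rewrite /K in Kx phiz *; lin_arith.
  have Ms : M < s by lin_arith.
  have [gi hphi] := pphi s t Ms st.
  have : phi t - phi s <= 0.
    rewrite hphi; try lin_arith.
    rewrite -[X in _ <= X](_ : integ s t (fun=> 0) = 0); last first.
      by rewrite integ_cst// mul0r.
    apply: le_integ_ae => //; first exact: itg_cst.
    have : {ae mu, forall u, s <= u -> u <= t -> g u <= - (1/2) * (rho u * phi u ^+ 2)}.
      apply: blow => // u su ut; have := lo u ltac:(lin_arith) ut; lin_arith.
    move=> h; apply: (@filterS2 _ _ aeF _ _ _ _ h rho0) => u h1 h2 su ut.
    apply: (le_trans (h1 su ut)).
    have : 0 <= rho u * phi u ^+ 2.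
      by rewrite mulr_ge0 ?sqr_ge0//; apply/ltW/h2; lin_arith.
    lin_arith.
  rewrite /K in ps pt *; lin_arith.
have [y zy hy] := div z 2 Mz.
have phiN0 x : z <= x -> x <= y -> phi x != 0.
  by move=> zx _; rewrite lt_eqF//; have := stay x zx; rewrite /K; lin_arith.
have [_ hV] := primitiveV zy (pphi z y Mz zy) phiN0.
have : 1/2 * integ z y rho <= (phi y)^-1 - (phi z)^-1.
  rewrite hV//; rewrite -integZ; last exact: irho.
  apply: le_integ_ae.
  - by apply: itgZ; exact: irho.
  - by case: (primitiveV zy (pphi z y Mz zy) phiN0).
  have h := blow z y Mz zy (fun t zt _ => stay t zt).
  apply: (@filterS _ _ aeF _ _ _ h) => t h1 zt ty.
  have p0 := phiN0 t zt ty.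
  have -> : 1/2 * rho t =
    - ((phi t)^-1 * (phi t)^-1 * (- (1/2) * (rho t * phi t ^+ 2))) by field.
  rewrite lerN2; apply: ler_wpM2l; last exact: h1.
  by rewrite -expr2 sqr_ge0.
have : (phi y)^-1 < 0 by rewrite invr_lt0; have := stay y zy; rewrite /K; lin_arith.
have : - 1 < (phi z)^-1.
  rewrite ltrNl -invrN invf_lt1; rewrite /K in phiz; lin_arith.
lin_arith.
Qed.

(** Suppose phi descends from 1/2 + h to 1/2 inside this band. As phi changes
by less than h over one window, the descent takes longer than l, so the last
window of it lies in the band; there riccati_lower and the hypothesis on the
averages make phi increase, whereas it ends at its minimum 1/2. *)
Lemma riccati_trap (x0 b l C e d h : R) rho kap phi g :
  0 < l -> 0 < e -> e <= 1/2 -> 0 <= d -> 2 * d <= e / 4 ->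
  0 < h -> h <= 1/2 -> h ^+ 2 <= e / 4 ->
  (forall x y, x0 <= x -> itg x y rho) -> (forall x y, x0 <= x -> itg x y kap) ->
  {ae mu, forall t, x0 <= t -> 0 < rho t} ->
  {ae mu, forall t, x0 <= t -> `|kap t| <= C * rho t} ->
  0 <= C ->
  (forall x, x0 <= x -> C * integ x (x + l) rho < h) ->
  (forall x, x0 <= x ->
     (- (1/4) + e) * integ x (x + l) rho <= integ x (x + l) kap) ->
  primitive x0 b phi g ->
  {ae mu, forall t, x0 <= t -> t <= b -> perturbed_riccati d rho kap phi g t} ->
  phi x0 = 1/2 + h ->
  forall x, x0 <= x -> x <= b -> 1/2 <= phi x.
Proof.
move=> l0 e0 e2 d0 de h0 h2 he irho ikap rho0 kapC C0 small avg pphi hg phi0 x x0x xb.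
rewrite leNgt; apply/negP => phix.
have px := primitiveS (lexx x0) xb pphi.
have [| | |s [t [[zs st tx] [ps pt lo up]]]] :=
  @down_crossing _ _ x0 x (1/2 + h) (1/2) x0x (primitive_cont px).
- by rewrite phi0.
- lin_arith.
- lin_arith.
have low u v : s <= u -> u <= v -> v <= t ->
    integ u v (fun r => (1/4 - e/2) * rho r + kap r) <= phi v - phi u.
  move=> su uv vt.
  have [gi hphi] := @primitiveS R x0 b u v phi g ltac:(lin_arith) ltac:(lin_arith) pphi.
  rewrite hphi; try lin_arith.
  apply: le_integ_ae => //.
    by apply: itgD; [apply: itgZ; apply: irho; lin_arith|apply: ikap; lin_arith].
  apply: (@filterS2 _ _ aeF _ _ _ _ rho0 hg) => r h3 h4 ur rv.
  have r0 : 0 < rho r by apply: h3; lin_arith.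
  have hr : perturbed_riccati d rho kap phi g r by apply: h4; lin_arith.
  have lor : 1/2 <= phi r by apply: lo; lin_arith.
  have upr : phi r <= 1/2 + h by apply: up; lin_arith.
  exact: (riccati_lower d0 de (ltW h0) h2 he r0 hr lor upr).
have rho_ge0 u v : x0 <= u -> {ae mu, forall r, u <= r -> r <= v -> 0 <= rho r}.
  by move=> xu; apply: (@filterS _ _ aeF _ _ _ rho0) => r h3 ur _; apply/ltW/h3; lin_arith.
have [tsl|tsl] := leP (t - s) l.
- have := low s t (lexx _) st (lexx _).
  have irk : itg s t (fun r => (1/4 - e/2) * rho r + kap r).
    by apply: itgD; [apply: itgZ; apply: irho; lin_arith|apply: ikap; lin_arith].
  have : integ s t (fun r => - C * rho r) <=
         integ s t (fun r => (1/4 - e/2) * rho r + kap r).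
    apply: le_integ_ae => //; first by apply: itgZ; apply: irho; lin_arith.
    apply: (@filterS2 _ _ aeF _ _ _ _ rho0 kapC) => r h3 h4 sr rt.
    have r0 : 0 < rho r by apply: h3; lin_arith.
    have := h4 ltac:(lin_arith); rewrite ler_norml => /andP[+ _]; nonlin_arith.
  rewrite integZ; last by apply: irho; lin_arith.
  have : integ s t rho <= integ s (s + l) rho.
    by apply: integ_subset_le; try lin_arith; [apply: irho; lin_arith|apply: rho_ge0; lin_arith].
  have := small s ltac:(lin_arith); rewrite ps pt; nonlin_arith.
- have := low (t - l) t ltac:(lin_arith) ltac:(lin_arith) (lexx _).
  have := lo (t - l) ltac:(lin_arith) ltac:(lin_arith).
  have := avg (t - l) ltac:(lin_arith); rewrite subrK.
  rewrite integD ?integZ; [|apply: irho; lin_arith|apply: itgZ; apply: irho; lin_arith|apply: ikap; lin_arith].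
  have : 0 < integ (t - l) t rho.
    apply: integ_gt0_ae; [lin_arith|apply: irho; lin_arith|].
    by apply: (@filterS _ _ aeF _ _ _ rho0) => r h3 ur _; apply/h3; lin_arith.
  rewrite pt; nonlin_arith.
Qed.

End Riccati.

(** * Averages over windows of fixed length *)

Section Averaging.
Context {R : realType}.
Notation mu := (@lebesgue_measure R).
Implicit Types (f g : R -> R).

Let aeF := ae_filter_ringOfSetsType mu.

(** The integral over [x, x + l] is continuous in x, and a set of full measure
is dense. *)
Lemma window_ge0_everywhere (M l : R) f : 0 < l ->
  (forall x y, M < x -> itg x y f) ->
  {ae mu, forall x, M < x -> 0 <= integ x (x + l) f} ->
  forall x, M < x -> 0 <= integ x (x + l) f.
Proof.
move=> l0 fi hae x Mx; rewrite leNgt; apply/negP => neg.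
pose F y := 0 + integ x y f.
have pF : primitive x (x + l + 1) F f by apply: primitive_integ; exact: fi.
have cF := primitive_cont pF.
set D := integ x (x + l) f in neg.
have [d d0 hd] := cF x ltac:(lin_arith) ltac:(lin_arith) (- D / 2) ltac:(lin_arith).
have [d' d'0 hd'] := cF (x + l) ltac:(lin_arith) ltac:(lin_arith) (- D / 2) ltac:(lin_arith).
pose m := Num.min 1 (Num.min d d').
have [m1 md md'] : [/\ m <= 1, m <= d & m <= d'].
  by rewrite /m !ge_min !lexx !orbT.
have m0 : 0 < m by rewrite /m !lt_min d0 d'0 ltr01.
have [y [xy yb hy]] := @ae_itv_exists R x (x + m / 2) (fun x => M < x -> 0 <= integ x (x + l) f)
  ltac:(lin_arith) (@filterS _ _ aeF _ _ (fun t h _ _ => h) hae).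
have := hy ltac:(lin_arith).
have [_ hF] := pF; rewrite -hF; try lin_arith.
have := hd y ltac:(lin_arith) ltac:(lin_arith); rewrite ger0_norm; last lin_arith.
have := hd' (y + l) ltac:(lin_arith) ltac:(lin_arith); rewrite ger0_norm; last lin_arith.
move=> /(_ ltac:(lin_arith)) + /(_ ltac:(lin_arith)).
have -> : F (x + l) = D by rewrite /F add0r.
have -> : F x = 0 by rewrite /F add0r integ_pt.
rewrite !ltr_norml; lin_arith.
Qed.

(** At a point x where the oscillation of rho is at most d rho(x), the integral
of rho Q is within C d rho(x) of rho(x) times the integral of Q, and the
integral of rho is within d rho(x) of rho(x) l. *)
Lemma averaged_le (M l C q e d : R) rho Q kap : 0 < l -> 0 < e -> 0 <= C ->
  (forall x y, M < x -> itg x y rho) ->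
  (forall x y, M < x -> itg x y kap) ->
  (forall x y, M < x -> itg x y Q) ->
  {ae mu, forall t, M < t -> 0 < rho t} ->
  {ae mu, forall t, M < t -> `|Q t| <= C} ->
  {ae mu, forall t, M < t -> kap t = rho t * Q t} ->
  0 <= d -> d * (C + `|q + e|) <= e * l ->
  {ae mu, forall x, M < x ->
     integ x (x + l) (fun t => `|rho t - rho x|) <= d * rho x} ->
  (forall x, M < x -> integ x (x + l) Q <= q * l) ->
  forall x, M < x -> integ x (x + l) kap <= (q + e) * integ x (x + l) rho.
Proof.
move=> l0 e0 C0 irho ikap iQ rho0 QC kapE d0 dsmall osc avg x Mx.
have ih u v : M < u -> itg u v (fun t => (q + e) * rho t - kap t).
  by move=> Mu; apply: itgB; [apply: itgZ; exact: irho|exact: ikap].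
suff : 0 <= integ x (x + l) (fun t => (q + e) * rho t - kap t).
  rewrite integB ?integZ; [lin_arith|exact: irho|apply: itgZ; exact: irho|exact: ikap].
move: x Mx; apply: window_ge0_everywhere => //.
suff key (x : R) : M < x -> 0 < rho x ->
    integ x (x + l) (fun t => `|rho t - rho x|) <= d * rho x ->
    0 <= integ x (x + l) (fun t => (q + e) * rho t - kap t).
  by apply: (@filterS2 _ _ aeF _ _ _ _ rho0 osc) => t h1 h2 Mt; apply: key; auto.
move=> Mx r0 od; have {avg} av := avg x Mx.
have ir : itg x (x + l) rho by exact: irho.
have iq : itg x (x + l) Q by exact: iQ.
have ik : itg x (x + l) kap by exact: ikap.
have ic : itg x (x + l) (fun=> rho x) by exact: itg_cst.
have io : itg x (x + l) (fun t => `|rho t - rho x|) by apply: itg_norm; apply: itgB.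
rewrite integB ?integZ//; last by apply: itgZ.
have k1 : integ x (x + l) kap - rho x * integ x (x + l) Q <= C * (d * rho x).
  rewrite -integZ// -integB//; last exact: itgZ.
  apply: le_trans (ler_wpM2l C0 od).
  rewrite -integZ//; apply: le_integ_ae; [apply: itgB => //; exact: itgZ|exact: itgZ|].
  apply: (@filterS2 _ _ aeF _ _ _ _ QC kapE) => t h3 h4 xt _.
  have Mt : M < t by lin_arith.
  rewrite h4// -mulrBl; apply: (le_trans (ler_norm _)).
  by rewrite normrM mulrC; apply: ler_wpM2r => //; exact: h3.
have k2 : `|integ x (x + l) rho - rho x * l| <= d * rho x.
  have -> : rho x * l = integ x (x + l) (fun=> rho x).
    by rewrite integ_cst ?lerDl ?ltW//; ring.
  rewrite -integB//; apply: le_trans od; apply: integ_norm; exact: itgB.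
have k3 : `|(q + e) * (integ x (x + l) rho - rho x * l)| <= `|q + e| * (d * rho x).
  by rewrite normrM; apply: ler_wpM2l.
move: k3; rewrite ler_norml => /andP[k3 _].
have k4 := ler_wpM2l (ltW r0) av.
have k5 := ler_wpM2l (ltW r0) dsmall.
lin_arith.
Qed.

End Averaging.

(** * Linear systems with integrable coefficients *)

Section LinearSystems.
Context {R : realType}.
Notation mu := (@lebesgue_measure R).
Implicit Types (m n u w : R -> R).

Let aeF := ae_filter_ringOfSetsType mu.
Local Notation h := (2^-1 : R).

Lemma le0_of_geometric (D B : R) : (forall k, D <= B * h ^+ k) -> D <= 0.
Proof.
move=> hD; rewrite leNgt; apply/negP => D0.
have := @cvg_geometric R B h; rewrite ger0_norm ?invr_ge0//.
move=> /(_ ltac:(lra)) /cvgrPdist_lt /(_ D D0) [N _ /(_ N (leqnn _))].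
rewrite /= sub0r normrN => lt; have := hD N; rewrite leNgt => /negP; apply.
exact: le_lt_trans (ler_norm _) lt.
Qed.

(** The sequence s k - 2 A 2^-k is nondecreasing and s k + 2 A 2^-k is
nonincreasing; L is their common separating value. *)
Lemma geometric_limit (s : nat -> R) (A : R) :
  (forall k, `|s k.+1 - s k| <= A * h ^+ k) ->
  exists L, forall k, `|L - s k| <= 2 * A * h ^+ k.
Proof.
move=> hs.
have step k d : `|s (k + d)%N - s k| <= 2 * A * (h ^+ k - h ^+ (k + d)).
  elim: d => [|d IH]; first by rewrite addn0 !subrr normr0 mulr0.
  have := hs (k + d)%N; move: IH.
  have e : h ^+ (k + d).+1 = h ^+ (k + d) / 2 by rewrite exprSr.
  by rewrite addnS e !ler_norml => /andP[? ?] /andP[? ?]; apply/andP; split; lra.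
have hk0 k : 0 <= h ^+ k by rewrite exprn_ge0// invr_ge0.
have A0 : 0 <= A by have := le_trans (normr_ge0 _) (hs 0%N); rewrite expr0 mulr1.
pose E := [set s k - 2 * A * h ^+ k | k in [set: nat]].
have ubk k : ubound E (s k + 2 * A * h ^+ k).
  move=> _ [j _ <-].
  have hj := hk0 j; have hk := hk0 k.
  have [jk|kj] := leqP j k.
    have := step j (k - j)%N; rewrite subnKC// ler_norml => /andP[? ?]; nra.
  have := step k (j - k)%N; rewrite (subnKC (ltnW kj)) ler_norml => /andP[? ?]; nra.
have supE : has_sup E.
  by split; [exists (s 0%N - 2 * A * h ^+ 0); exists 0%N | exists (s 0%N + 2 * A * h ^+ 0)].
exists (sup E) => k; rewrite ler_distl; apply/andP; split.
  by apply: ub_le_sup; [case: supE | exists k].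
by apply: ge_sup; [case: supE | exact: ubk].
Qed.

(** Take W = exp (4 N) with N a primitive of k. Since W' = 4 k W, the integral
of W k should be at most W / 4; the weaker bound W / 2 needs only the
inequality 1 + x <= exp x on short intervals, and still makes Picard iteration a
contraction for the norm weighted by W. *)
Lemma exponential_weight (a : R) (k : R -> R) :
  (forall x, itg a x k) -> (forall t, 0 <= k t) ->
  exists W : R -> R, [/\ forall x, 0 < W x,
    forall x y, a <= x -> x <= y -> W x <= W y,
    forall x, bmeas a x W,
    forall x, a <= x -> integ a x k <= W x &
    forall x, a <= x -> integ a x (fun t => W t * k t) <= W x / 2].
Proof.
move=> ik k0.
have [N NE Na] : exists2 N : R -> R, forall x, primitive a x N k & N a = 0.
  exists (fun x => 0 + integ a x k); last by rewrite integ_pt addr0.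
  by move=> x; exact: primitive_integ.
have [W [WE mW W_gt0 WN]] : exists W : R -> R, [/\
    forall s t, W t = W s * expR (4 * (N t - N s)),
    forall x, measurable_fun `[a, x] W, forall x, 0 < W x &
    forall x, 1 + 4 * N x <= W x].
  exists (fun x => expR (4 * N x)); split.
  - by move=> s t; rewrite -expRD; congr expR; ring.
  - move=> x; change (measurable_fun `[a, x] (expR \o (fun x => 4 * N x))).
    apply: measurableT_comp; first exact: measurable_expR.
    apply: measurable_funM; first exact: measurable_cst.
    by case: (primitive_bmeas (NE x)).
  - by move=> x; exact: expR_gt0.
  - by move=> x; exact: expR_ge1Dx.
have dN x y : a <= x -> x <= y -> N y - N x = integ x y k.
  by move=> ax xy; case: (NE y) => _; apply.
have dN0 x y : a <= x -> x <= y -> 0 <= N y - N x.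
  by move=> ax xy; rewrite dN//; exact: integ_ge0.
have WD s t : a <= s -> s <= t -> W s * (1 + 4 * (N t - N s)) <= W t.
  by move=> as_ st; rewrite (WE s t); apply: ler_wpM2l; [exact: ltW|exact: expR_ge1Dx].
have W_mono x y : a <= x -> x <= y -> W x <= W y.
  move=> ax xy; have := WD x y ax xy; have := dN0 x y ax xy.
  have := W_gt0 x; nra.
have bW x : bmeas a x W.
  split => //; exists (W x) => t at_ tx; rewrite ger0_norm ?W_mono//; exact: ltW.
exists W; split => // x ax.
  have := dN0 a x (lexx _) ax; have := WN x.
  rewrite -dN// Na; lra.
have Wa := W_gt0 a.
suff : integ a x (fun t => W t * k t) <= (W x - W a) / 2 by lra.
have iWk y : itg a y (fun t => W t * k t) by exact: itgM.
apply: (@local_to_global _ (fun s t =>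
  integ s t (fun t => W t * k t) <= (W t - W s) / 2)) => //.
  move=> s t r as_ st tr rx Pst Ptr.
  rewrite (integ_split st tr (itgS as_ (lexx _) (iWk r))); lra.
move=> c ac cx.
have [d d0 hd] := primitive_cont (NE x) ac cx (ltac:(lra) : 0 < 1/16 :> R).
exists d => // s t as_ sc ct tx sd td.
have st : s <= t by lra.
have Ns : `|N s - N c| < 1/16.
  by apply: hd; [lra|lra|rewrite ltr_norml; apply/andP; split; lra].
have Nt : `|N t - N c| < 1/16.
  by apply: hd; [lra|lra|rewrite ltr_norml; apply/andP; split; lra].
have D0 := dN0 s t as_ st.
have D8 : N t - N s <= 1/8.
  by move: Ns Nt; rewrite !ltr_norml => /andP[? ?] /andP[? ?]; lra.
have Ws := W_gt0 s; have Wt := W_gt0 t.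
have x2 : W t * (1 + 4 * (N s - N t)) <= W s.
  by rewrite (WE t s); apply: ler_wpM2l; [exact: ltW|exact: expR_ge1Dx].
have x1 := WD s t as_ st.
have iwk : integ s t (fun r => W r * k r) <= W t * (N t - N s).
  have ikst : itg s t k by apply: itgS (ik t).
  rewrite dN// -integZ//; apply: le_integ.
  - by apply: itgS (iWk t).
  - exact: itgZ.
  - move=> r sr rt; apply: ler_wpM2r; first exact: k0.
    by apply: W_mono => //; lra.
apply: (le_trans iwk); move: D0 D8 x1 x2.
move: (N t - N s) (N s - N t) (opprB (N t) (N s)) => D D' <-.
move: (W s) (W t) Ws Wt => p q p0 q0 D0 D8 x1 x2.
have q2 : q <= 2 * p by nra.
nra.
Qed.

Section Picard.
Variables (a : R) (m n : R -> R) (al be : R).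
Hypotheses (im : forall x, itg a x m) (in_ : forall x, itg a x n).
Variables (k W : R -> R).
Hypotheses (m_le : forall t, `|m t| <= k t) (n_le : forall t, `|n t| <= k t).
Hypotheses (ik : forall x, itg a x k) (k0 : forall t, 0 <= k t).
Hypotheses (W_gt0 : forall x, 0 < W x)
  (W_mono : forall x y, a <= x -> x <= y -> W x <= W y)
  (W_bmeas : forall x, bmeas a x W)
  (W_ge : forall x, a <= x -> integ a x k <= W x)
  (weight_contraction : forall x, a <= x ->
     integ a x (fun t => W t * k t) <= W x / 2).

(** One integration against p gains a factor 1/2 in the weighted norm. *)
Let contraction (p v v' : R -> R) (B x : R) : a <= x -> 0 <= B ->
  (forall t, `|p t| <= k t) -> itg a x p -> bmeas a x v -> bmeas a x v' ->
  (forall t, a <= t -> `|v' t - v t| <= B * W t) ->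
  `|integ a x (fun t => v' t * p t) - integ a x (fun t => v t * p t)|
    <= B * h * W x.
Proof.
move=> ax B0 pk ip bv bv' hv.
have i1 : itg a x (fun t => v t * p t) by exact: itgM.
have i2 : itg a x (fun t => v' t * p t) by exact: itgM.
have i3 : itg a x (fun t => W t * k t) by exact: itgM.
rewrite -integB//; apply: (le_trans (integ_norm (itgB i2 i1))).
apply: (@le_trans _ _ (B * integ a x (fun t => W t * k t))).
  rewrite -integZ//; apply: le_integ; [apply: itg_norm; exact: itgB|exact: itgZ|].
  move=> t at_ tx; rewrite -mulrBl normrM mulrA.
  by apply: ler_pM => //; exact: hv.
have := ler_wpM2l B0 (weight_contraction ax); lra.
Qed.

Fixpoint picard (j : nat) : (R -> R) * (R -> R) :=
  if j is i.+1 then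
    (fun x => al + integ a x (fun t => (picard i).2 t * m t),
     fun x => be + integ a x (fun t => (picard i).1 t * n t))
  else (fun=> al, fun=> be).

Let picard_bmeas j x : bmeas a x (picard j).1 /\ bmeas a x (picard j).2.
Proof.
elim: j => [|j [b1 b2]] /=.
  by split; exact: primitive_bmeas (primitive_cst _ _ _).
by split; apply: primitive_bmeas; apply: primitive_integ; exact: itgM.
Qed.

Local Notation A := (`|al| + `|be|).

Let base (p : R -> R) (c x : R) : a <= x -> (forall t, `|p t| <= k t) ->
  itg a x p -> `|c| <= A -> `|integ a x (fun t => c * p t)| <= A * W x.
Proof.
move=> ax pk ip cA; rewrite integZ// normrM; apply: ler_pM => //.
apply: (le_trans (integ_norm ip)).
apply: le_trans (W_ge ax); apply: le_integ => //; exact: itg_norm.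
Qed.

Let picard_step j x : a <= x ->
  `|(picard j.+1).1 x - (picard j).1 x| <= A * W x * h ^+ j /\
  `|(picard j.+1).2 x - (picard j).2 x| <= A * W x * h ^+ j.
Proof.
have A0 : 0 <= A by rewrite addr_ge0.
have h0 i : 0 <= h ^+ i by rewrite exprn_ge0// invr_ge0.
elim: j x => [|j IH] x ax.
  rewrite expr0 mulr1 /= ![_ + integ _ _ _ - _]addrAC !subrr !add0r.
  by split; apply: base => //; rewrite ?lerDl ?lerDr.
have [b1 b2] := picard_bmeas j x; have [b1' b2'] := picard_bmeas j.+1 x.
have -> : A * W x * h ^+ j.+1 = A * h ^+ j * h * W x by rewrite exprSr; ring.
rewrite [picard j.+2]/= [in X in _ - X]/=; split => /=.
- rewrite opprD addrACA subrr add0r.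
  apply: (contraction ax (mulr_ge0 A0 (h0 j)) m_le (im x) b2 b2').
  by move=> t at_; rewrite mulrAC; case: (IH t at_).
- rewrite opprD addrACA subrr add0r.
  apply: (contraction ax (mulr_ge0 A0 (h0 j)) n_le (in_ x) b1 b1').
  by move=> t at_; rewrite mulrAC; case: (IH t at_).
Qed.

Let limit_function (f : nat -> R -> R) :
  (forall j x, bmeas a x (f j)) ->
  (forall j x, a <= x -> `|f j.+1 x - f j x| <= A * W x * h ^+ j) ->
  exists2 g : R -> R, forall x, bmeas a x g &
    forall j x, a <= x -> `|g x - f j x| <= 2 * (A * W x) * h ^+ j.
Proof.
move=> bf hf.
have : forall x, exists L, a <= x ->
    forall j, `|L - f j x| <= 2 * (A * W x) * h ^+ j.
  move=> x; have [ax|_] := boolP (a <= x); last by exists 0.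
  have [L hL] := @geometric_limit (f ^~ x) (A * W x) (fun j => hf j x ax).
  by exists L.
move=> /choice[g hg]; exists g; last by move=> j x ax; exact: hg.
move=> x; split.
  apply: (@measurable_fun_cvg _ _ _ _ f) => [j|t]; first by case: (bf j x).
  rewrite /= in_itv/= => /andP[at_ tx].
  apply/cvgrPdist_lt => e e0.
  have := @cvg_geometric R (2 * (A * W t)) h; rewrite ger0_norm ?invr_ge0//.
  move=> /(_ ltac:(lra)) /cvgrPdist_lt /(_ e e0).
  apply: filterS => j /=; rewrite sub0r normrN => lt.
  apply: le_lt_trans lt; apply: le_trans (ler_norm _); exact: hg.
have [_ [B hB]] := bf 0%N x.
exists (B + 2 * (A * W x)) => t at_ tx.
have := hg t at_ 0%N; rewrite expr0 mulr1 => h1.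
have := hB t at_ tx => h2; have h3 := W_mono at_ tx.
have A0 : 0 <= A by rewrite addr_ge0.
have h4 := ler_wpM2l A0 h3.
rewrite -(subrK (f 0%N t) (g t)); apply: (le_trans (ler_normD _ _)); lra.
Qed.

Lemma weighted_system_exists : exists u w, [/\ u a = al, w a = be,
  forall x, primitive a x u (fun t => w t * m t) &
  forall x, primitive a x w (fun t => u t * n t)].
Proof.
have [u bu hu] := limit_function (fun j x => (picard_bmeas j x).1)
  (fun j x ax => (picard_step j ax).1).
have [w bw hw] := limit_function (fun j x => (picard_bmeas j x).2)
  (fun j x ax => (picard_step j ax).2).
have A0 : 0 <= A by rewrite addr_ge0.
have h0 i : 0 <= h ^+ i by rewrite exprn_ge0// invr_ge0.
have fixp (p : R -> R) (c : R) (f g : nat -> R -> R) (v z : R -> R) :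
    (forall t, `|p t| <= k t) -> (forall x, itg a x p) ->
    (forall j x, bmeas a x (f j)) -> (forall x, bmeas a x v) ->
    (forall j x, f j.+1 x = c + integ a x (fun t => g j t * p t)) ->
    (forall x, bmeas a x z) -> (forall j x, bmeas a x (g j)) ->
    (forall j x, a <= x -> `|v x - f j x| <= 2 * (A * W x) * h ^+ j) ->
    (forall j x, a <= x -> `|z x - g j x| <= 2 * (A * W x) * h ^+ j) ->
    forall x, a <= x -> v x = c + integ a x (fun t => z t * p t).
  move=> pk ip bf bv fE bz bg hv hz x ax.
  apply/eqP; rewrite -subr_eq0 -normr_le0.
  apply: (@le0_of_geometric _ (2 * (A * W x))) => j.
  have h1 := hv j.+1 x ax.
  have h2 : `|integ a x (fun t => z t * p t) - integ a x (fun t => g j t * p t)|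
      <= 2 * A * h ^+ j * h * W x.
    have B0 : 0 <= 2 * A * h ^+ j by rewrite !mulr_ge0.
    apply: (contraction ax B0 pk (ip x) (bg j x) (bz x)).
    by move=> t at_; have := hz j t at_; rewrite -!mulrA [W t * _]mulrC.
  rewrite fE in h1; move: h1 h2; rewrite exprS !ler_norml.
  by move=> /andP[? ?] /andP[? ?]; apply/andP; split; lra.
have uE := fixp m al (fun j => (picard j).1) (fun j => (picard j).2) u w m_le im
  (fun j x => (picard_bmeas j x).1) bu (fun _ _ => erefl) bw
  (fun j x => (picard_bmeas j x).2) hu hw.
have wE := fixp n be (fun j => (picard j).2) (fun j => (picard j).1) w u n_le in_
  (fun j x => (picard_bmeas j x).2) bw (fun _ _ => erefl) bu
  (fun j x => (picard_bmeas j x).1) hw hu.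
exists u, w; split.
- by rewrite uE// integ_pt addr0.
- by rewrite wE// integ_pt addr0.
- move=> x; apply: (@eq_primitive _ _ _ (fun x => al + integ a x (fun t => w t * m t))
    _ (fun t => w t * m t)) => //; first by move=> t at_ _; rewrite -uE.
  by apply: primitive_integ; exact: itgM.
- move=> x; apply: (@eq_primitive _ _ _ (fun x => be + integ a x (fun t => u t * n t))
    _ (fun t => u t * n t)) => //; first by move=> t at_ _; rewrite -wE.
  by apply: primitive_integ; exact: itgM.
Qed.

End Picard.

Lemma linear_system_exists (a : R) (m n : R -> R) (al be : R) :
  (forall x, itg a x m) -> (forall x, itg a x n) ->
  exists u w : R -> R, [/\ u a = al, w a = be,
    forall x, primitive a x u (fun t => w t * m t) &
    forall x, primitive a x w (fun t => u t * n t)].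
Proof.
move=> im in_; pose k t := `|m t| + `|n t|.
have ik x : itg a x k by apply: itgD; exact: itg_norm.
have k0 t : 0 <= k t by rewrite addr_ge0.
have [W [W0 Wm bW Wge Wc]] := exponential_weight ik k0.
apply: (@weighted_system_exists _ _ _ _ _ im in_ k W) => //.
- by move=> t; rewrite lerDl.
- by move=> t; rewrite lerDr.
Qed.

Lemma integ_pos_weight (p q : R) m w : p < q -> bmeas p q w -> itg p q m ->
  {ae mu, forall t, p <= t -> t <= q -> 0 < m t} ->
  (forall t, p <= t -> t <= q -> 0 < w t) -> 0 < integ p q (fun t => w t * m t).
Proof.
move=> pq bw im m0 w0; apply: integ_gt0_ae => //; first exact: itgM.
apply: (@filterS _ _ aeF _ _ _ m0) => t hm pt tq.
by rewrite mulr_gt0 ?hm ?w0.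
Qed.

(** Where u vanishes, w keeps a sign nearby and u is strictly monotone, so the
zero is isolated. This includes the endpoint a, at which zeros could otherwise
accumulate. *)
Lemma finite_zeros (a b : R) m n u w : a <= b -> itg a b m ->
  {ae mu, forall t, a <= t -> t <= b -> 0 < m t} ->
  primitive a b u (fun t => w t * m t) -> primitive a b w (fun t => u t * n t) ->
  (forall x, a <= x -> x <= b -> u x = 0 -> w x != 0) ->
  finite_set [set x | [/\ a <= x, x <= b & u x = 0]].
Proof.
move=> ab im m0 pu pw uw.
apply: (@local_to_global _ (fun s t =>
  finite_set [set x | [/\ s <= x, x <= t & u x = 0]])) => //.
  move=> s t r as_ st tr rb f1 f2.
  apply: (sub_finite_set (B := [set x | [/\ s <= x, x <= t & u x = 0]] `|`
     [set x | [/\ t <= x, x <= r & u x = 0]])); last by rewrite finite_setU.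
  move=> x [sx xr ux]; have [xt|tx] := leP x t; first by left.
  by right; split => //; exact: ltW.
move=> c ac cb; have [uc|uc] := eqVneq (u c) 0; last first.
  have [d d0 hd] := primitive_cont pu ac cb (ltac:(by rewrite normr_gt0) : 0 < `|u c|).
  exists d => // s t as_ sc ct tb sd td.
  apply: (sub_finite_set (B := set0)); last exact: finite_set0.
  move=> x [sx xt ux].
  suff xc : `|x - c| < d.
    by have := hd x ltac:(lra) ltac:(lra) xc; rewrite ux sub0r normrN ltxx.
  by rewrite ltr_norml; apply/andP; split; lra.
have wc := uw c ac cb uc.
have [d d0 hd] := primitive_cont pw ac cb (ltac:(by rewrite normr_gt0) : 0 < `|w c|).
exists d => // s t as_ sc ct tb sd td.
apply: (sub_finite_set (B := [set c])); last exact: finite_set1.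
move=> x [sx xt ux] /=.
have near_c y : s <= y -> y <= t -> 0 < w y * w c.
  move=> sy yt; have := hd y ltac:(lra) ltac:(lra).
  move=> /(_ ltac:(by rewrite ltr_norml; apply/andP; split; lra)).
  have [wc0|wc0|wc0] := ltgtP (w c) 0; last by rewrite wc0 eqxx in wc.
  - by rewrite (ltr0_norm wc0) ltr_norml => /andP[? ?]; nra.
  - by rewrite (gtr0_norm wc0) ltr_norml => /andP[? ?]; nra.
have no_zero (p q : R) : s <= p -> p < q -> q <= t -> u p = 0 -> u q = 0 -> False.
  move=> sp pq qt up uq.
  have [_ hu] := pu.
  have : integ p q (fun r => w r * m r) = 0.
    by rewrite -hu ?up ?uq ?subrr; lra.
  have ipq : itg p q m by apply: itgS im; lra.
  have bpq : bmeas p q w.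
    by apply: bmeas_sub (primitive_bmeas pw); lra.
  have bc : bmeas p q (fun=> w c) by exact: primitive_bmeas (primitive_cst _ _ _).
  have : 0 < integ p q (fun r => w r * w c * m r).
    apply: integ_pos_weight => //; first exact: bmeasM.
    - by apply: (@filterS _ _ aeF _ _ _ m0) => r hr pr rq; apply: hr; lra.
    - by move=> r pr rq; apply: near_c; lra.
  rewrite (@eq_integ _ p q _ (fun r => w c * (w r * m r))); last by move=> *; ring.
  rewrite integZ; last exact: itgM.
  by move=> + h0; rewrite h0 mulr0 ltxx.
have [xc|xc|//] := ltgtP x c.
- by case: (no_zero x c) => //; lra.
- by case: (no_zero c x) => //; lra.
Qed.

End LinearSystems.

(** * Solutions of Sturm-Liouville equations as systems *)

Section Solutions.
Context {R : realType}.
Notation mu := (@lebesgue_measure R).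

Let aeF := ae_filter_ringOfSetsType mu.

Definition ray_lo (a : R) (n : nat) : R := a + n.+1%:R^-1.
Definition ray_hi (a : R) (n : nat) : R := a + n.+1%:R + 1.

Lemma ray_lo_gt a n : a < ray_lo a n.
Proof. by rewrite ltrDl invr_gt0 ltr0n. Qed.

Lemma ray_exhaust (a x : R) : a < x -> exists n, ray_lo a n < x /\ x < ray_hi a n.
Proof.
move=> ax; have xa : 0 < x - a by lin_arith.
exists (Num.truncn ((x - a)^-1 + (x - a))).
set n := Num.truncn _.
have lt : (x - a)^-1 + (x - a) < n.+1%:R by exact: truncnS_gt.
have i0 : 0 < (x - a)^-1 by rewrite invr_gt0.
rewrite /ray_lo /ray_hi; split; last lin_arith.
rewrite -ltrBrDl.
by rewrite invf_plt ?posrE ?ltr0n//; apply: lt_trans lt; rewrite ltrDl.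
Qed.

Lemma measurable_on_ray (a : R) (f : R -> R) :
  (forall x y, a < x -> measurable_fun `[x, y] f) -> measurable_fun `]a, +oo[ f.
Proof.
move=> hf.
have -> : `]a, +oo[%classic = \bigcup_n `[ray_lo a n, ray_hi a n]%classic.
  apply/seteqP; split => [x /=|x [n _]] /=; rewrite !in_itv/= ?andbT.
    by move=> /ray_exhaust[n [/ltW? /ltW?]]; exists n => //=; rewrite in_itv/=; apply/andP.
  by move=> /andP[h _]; apply: lt_le_trans h; exact: ray_lo_gt.
by apply/measurable_fun_bigcup => // n; apply: hf; exact: ray_lo_gt.
Qed.

Lemma locally_integrable_itg (a : R) (f : R -> R) :
  locally_integrable `]a, +oo[ f -> forall x y, a < x -> itg x y f.
Proof.
move=> [mf _ hf] x y ax.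
have sub : `[x, y]%classic `<=` `]a, +oo[%classic.
  by move=> t /=; rewrite !in_itv/= andbT => /andP[xt _]; exact: lt_le_trans xt.
apply/integrableP; split.
  by apply/measurable_EFinP; apply: measurable_funS mf.
by apply: hf => //; exact: segment_compact.
Qed.

Lemma itg_locally_integrable (a : R) (f : R -> R) :
  (forall x y, a < x -> itg x y f) -> locally_integrable `]a, +oo[ f.
Proof.
move=> hf; split.
- by apply: measurable_on_ray => x y ax; apply: itg_meas; exact: hf.
- exact: interval_open.
move=> K KD cK; have [->|/set0P K0] := eqVneq K set0.
  by rewrite integral_set0.
have cid : {within K, continuous (@idfun R)} by apply: continuous_subspaceT => ?.
have [c cK' hc] := compact_EVT_min K0 cK cid.
have [d dK' hd] := compact_EVT_max K0 cK cid.
have ac : a < c by have := KD c (set_mem cK'); rewrite /= in_itv/= andbT.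
have /integrableP[mf fi] := hf c d ac.
apply: le_lt_trans fi; apply: ge0_subset_integral => //.
- exact: compact_measurable.
- exact: (measurable_int mu (itg_norm (hf c d ac))).
- by move=> x Kx /=; rewrite in_itv/=; apply/andP; split; [exact: (hc x (mem_set Kx))|exact: (hd x (mem_set Kx))].
Qed.

(** Near x, F differs by a constant from the integral of f restricted to a
compact interval; the Lebesgue points of these countably many restrictions
cover almost every x. *)
Lemma derive1_primitive (a : R) (F f : R -> R) :
  (forall x y, a < x -> primitive x y F f) ->
  {ae mu, forall x, a < x -> derive1 F x = f x}.
Proof.
move=> pF.
pose fn n := f \_ `[ray_lo a n, ray_hi a n].
have fi n : mu.-integrable `[ray_lo a n, ray_hi a n] (EFin \o f).
  by case: (pF (ray_lo a n) (ray_hi a n) (ray_lo_gt a n)).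
have leb n : {ae mu, forall x, lebesgue_pt (fn n) x}.
  by apply: lebesgue_differentiation; apply: integrable_locally_restrict.
have /ae_foralln lebn := leb.
apply: (@filterS _ _ aeF _ _ _ lebn) => x hx ax.
have [n [cx xd]] := ray_exhaust ax.
set c := ray_lo a n in cx *; set d := ray_hi a n in xd *.
have ac : a < c by exact: ray_lo_gt.
have fE y : c <= y -> y <= d -> fn n y = f y.
  by move=> cy yd; rewrite /fn patchE mem_set//= in_itv/=; apply/andP.
have fni : mu.-integrable `[c, d] (EFin \o fn n).
  apply: (@eq_itg R c d f) (fi n) => y cy yd; by rewrite fE.
pose G y := \int[mu]_(t in `[c, y]) fn n t.
have [dG GE] : derivable G x 1 /\ derive1 G x = fn n x.
  have := @FTC1_lebesgue_pt R (fn n) (BLeft c) x d xd fni.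
  by apply; [rewrite lte_fin | exact: hx].
have near_eq : \near x, F x = (cst (F c) + G) x.
  have e0 : 0 < Num.min (x - c) (d - x) by rewrite lt_min !subr_gt0 cx.
  exists (Num.min (x - c) (d - x)) => //= y.
  rewrite /ball_/= lt_min !ltr_norml => /andP[/andP[y1 y2] /andP[y3 y4]].
  have cy : c <= y by lin_arith.
  have yd : y <= d by lin_arith.
  have [_ hF] := pF c d ac.
  rewrite -[RHS]/(F c + integ c y (fn n)).
  rewrite (@eq_integ R c y _ f) ?fE//; last by move=> t ct ty; rewrite fE//; lin_arith.
  by rewrite -hF// subrKC.
rewrite derive1E.
transitivity ('D_1 (cst (F c) + G) x); first exact: near_eq_derive near_eq.
rewrite deriveD//.
by rewrite derive_cst add0r -derive1E GE fE//; lin_arith.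
Qed.

(** For m = 1/p and n = q - E r this is (tau - E) u = 0 with quasi-derivative
w = p u'. *)
Definition is_system (a : R) (m n u w : R -> R) :=
  forall x y, a < x -> primitive x y u (fun t => w t * m t) /\
                       primitive x y w (fun t => u t * n t).

Lemma solution_system (a : R) (p q r : R -> R) (E : R) (u : R -> R) :
  coefficients a p q r -> solution a p q r E u ->
  exists2 w, is_system a (fun t => (p t)^-1) (fun t => q t - E * r t) u w &
    {ae mu, forall x, a < x -> w x = p x * derive1 u x}.
Proof.
move=> [lp lq lr pr0] [[g lg ug] [w [[k lk wk] wE hE]]].
exists w => //.
have gi := locally_integrable_itg lg.
have ki := locally_integrable_itg lk.
have pi := locally_integrable_itg lp.
have qi := locally_integrable_itg lq.
have ri := locally_integrable_itg lr.
have pu x y : a < x -> primitive x y u g.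
  move=> ax; split; first exact: gi.
  by move=> s t xs st ty; apply: ug => //; lin_arith.
have pw x y : a < x -> primitive x y w k.
  move=> ax; split; first exact: ki.
  by move=> s t xs st ty; apply: wk => //; lin_arith.
have du := derive1_primitive pu.
have dw := derive1_primitive pw.
have g_ae : {ae mu, forall x, a < x -> g x = w x * (p x)^-1}.
  apply: (@filterS3 _ _ aeF _ _ _ _ _ wE du pr0) => x h1 h2 h3 ax.
  have [p0 _] := h3 ax; rewrite h1// h2//; field; rewrite gt_eqF//.
have k_ae : {ae mu, forall x, a < x -> k x = u x * (q x - E * r x)}.
  apply: (@filterS3 _ _ aeF _ _ _ _ _ hE dw pr0) => x h1 h2 h3 ax.
  have [_ r0] := h3 ax; have := h1 ax; rewrite h2// => h.
  have r0' : r x != 0 by rewrite gt_eqF.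
  have : - k x + q x * u x = r x * (E * u x) by rewrite -h; field.
  lin_arith.
move=> x y ax; split.
- apply: (primitive_ae (pu x y ax)).
    by apply: itgM; [exact: primitive_bmeas (pw x y ax) | exact: pi].
  by apply: (@filterS _ _ aeF _ _ _ g_ae) => t h xt _; apply: h; lin_arith.
- apply: (primitive_ae (pw x y ax)).
    apply: itgM; first exact: primitive_bmeas (pu x y ax).
    by apply: itgB; [exact: qi | apply: itgZ; exact: ri].
  by apply: (@filterS _ _ aeF _ _ _ k_ae) => t h xt _; apply: h; lin_arith.
Qed.

Lemma system_solution (a : R) (p q r : R -> R) (E : R) (u w : R -> R) :
  coefficients a p q r ->
  is_system a (fun t => (p t)^-1) (fun t => q t - E * r t) u w ->
  solution a p q r E u.
Proof.
move=> [lp lq lr pr0] sys.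
have pu x y ax := (sys x y ax).1.
have pw x y ax := (sys x y ax).2.
have du := derive1_primitive pu.
have dw := derive1_primitive pw.
have ac (F f : R -> R) : (forall x y, a < x -> primitive x y F f) -> loc_abs_cont a F.
  move=> pF; exists f.
    by apply: itg_locally_integrable => x y ax; case: (pF x y ax).
  by move=> x y ax xy; case: (pF x y ax) => _; apply.
split; first exact: ac pu.
exists w; split; first exact: ac pw.
- apply: (@filterS2 _ _ aeF _ _ _ _ du pr0) => x h1 h2 ax.
  have [p0 _] := h2 ax; rewrite h1//; field; by rewrite gt_eqF.
- apply: (@filterS2 _ _ aeF _ _ _ _ dw pr0) => x h1 h2 ax.
  have [_ r0] := h2 ax; rewrite h1//; field; by rewrite gt_eqF.
Qed.

End Solutions.

(** * Integrals of functions known almost everywhere, and translations *)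

Section NonMeasurable.
Context d (T : measurableType d) (R : realType) (mu : {measure set T -> \bar R}).
Import HBNNSimple.
Local Open Scope ereal_scope.

Let aeF := ae_filter_ringOfSetsType mu.

Let simple_sup (f : T -> \bar R) := ereal_sup [set sintegral mu h |
  h in [set h : {nnsfun T >-> R} | forall x, (h x)%:E <= f x]].

(** A simple function below f can be replaced by 0 on the null set where f and
g differ, without changing its integral. *)
Let simple_sup_ae (f g : T -> \bar R) : (forall x, 0 <= g x) ->
  {ae mu, forall x, f x = g x} -> simple_sup f <= simple_sup g.
Proof.
move=> g0 [N [mN N0 fg]]; apply: ge_ereal_sup => _ [h /= hf <-].
have mNc := measurableC mN.
apply: ereal_sup_ubound; exists (proj_nnsfun h mNc) => /=.
  move=> x; rewrite mindicE; have [xN|xN] := boolP (x \in ~` N).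
    rewrite mulr1; have -> : g x = f x; last exact: hf.
    apply: contrapT => gf; move: xN; rewrite inE; apply; apply: fg => /= fgx.
    exact/gf/esym.
  by rewrite mulr0.
rewrite -!integralT_nnsfun; apply: ae_eq_integral => //.
- exact/measurable_EFinP.
- exact/measurable_EFinP.
exists N; split => // x /= h1; apply: contrapT => xN; apply: h1 => _.
by rewrite mindicE mem_set ?mulr1.
Qed.

(** Measurability of f and g is not assumed, so that f may involve a derivative
that exists only almost everywhere. *)
Lemma Rintegral_ae_eq (D : set T) (f g : T -> R) :
  {ae mu, forall x, D x -> f x = g x} ->
  (\int[mu]_(x in D) f x = \int[mu]_(x in D) g x)%R.
Proof.
move=> fg; congr fine; rewrite /integral.
have e : {ae mu, forall x, ((fun x => (f x)%:E) \_ D) x = ((fun x => (g x)%:E) \_ D) x}.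
  apply: (@filterS _ _ aeF _ _ _ fg) => x h; rewrite !patchE.
  by case: ifPn => // /set_mem Dx; rewrite h.
congr (_ - _); apply/eqP; rewrite eq_le; apply/andP; split;
  apply: simple_sup_ae => [x|]; rewrite ?funepos_ge0 ?funeneg_ge0//;
  by apply: (@filterS _ _ aeF _ _ _ e) => x h; rewrite ?funeposE ?funenegE h.
Qed.

End NonMeasurable.

Section Translation.
Context {R : realType}.
Notation mu := (@lebesgue_measure R).

Lemma pushforward_addr (x : R) (A : set R) : measurable A ->
  pushforward mu (fun t : measurableTypeR R => x + t : measurableTypeR R) A = mu A.
Proof.
have mf : measurable_fun [set: measurableTypeR R] (fun t : measurableTypeR R => x + t : measurableTypeR R).
  exact: measurable_funD.
move=> mA; apply/esym.
apply: (@lebesgue_measure_unique R (pushforward mu (fun t : measurableTypeR R => x + t : measurableTypeR R))) => //.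
move=> _ [[a b] _ <-].
rewrite /pushforward /=.
transitivity (mu `](a - x), (b - x)]%classic); last first.
  by congr (mu _); apply/seteqP; split => t /=; rewrite !in_itv/= ltrBlDl lerBrDl.
rewrite !lebesgue_measure_itv/= !lte_fin ltrD2r; case: ifP => // _.
by rewrite -!EFinD; congr EFin; ring.
Qed.

Lemma integ_shift (x l : R) (f : R -> R) : measurable_fun `[x, x + l] f ->
  \int[mu]_(t in `[0, l]) `|f (x + t)| = integ x (x + l) (fun t => `|f t|).
Proof.
move=> mf; rewrite /integ /Rintegral; congr fine.
pose phi := (fun t : measurableTypeR R => x + t : measurableTypeR R).
have mphi : measurable_fun [set: measurableTypeR R] phi by exact: measurable_funD.
have -> : `[0, l]%classic = phi @^-1` `[x, x + l].
  by apply/seteqP; split => t /=; rewrite !in_itv/= lerDl lerD2l.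
rewrite -[LHS](@ge0_integral_pushforward _ _ _ _ _ phi mphi mu `[x, x + l] (fun t => `|f t|%:E))//=.
- by apply: eq_measure_integral => A mA _; exact: pushforward_addr.
- by apply/measurable_EFinP; exact: measurableT_comp.
Qed.

End Translation.

(** * Divergent integrals *)

Section Divergence.
Context {R : realType}.
Notation mu := (@lebesgue_measure R).
Let aeF := ae_filter_ringOfSetsType mu.

Lemma integrable_oc_itg (a x : R) (f : R -> R) :
  mu.-integrable `]a, x] (EFin \o f) -> itg a x f.
Proof.
move=> /integrableP[mf fi].
have mf' : measurable_fun `]a, x] f by exact/measurable_EFinP.
have mc : measurable_fun `[a, x] f.
  by apply/(measurable_fun_itv_obnd_cbndP a (BRight x) f).
apply/integrableP; split; first exact/measurable_EFinP.
rewrite -integral_itv_obnd_cbnd//.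
by apply: measurableT_comp => //.
Qed.

Lemma integrable_oo_itg (a x : R) (f : R -> R) :
  mu.-integrable `]a, x[ (EFin \o f) -> itg a x f.
Proof.
move=> /integrableP[mf fi]; apply: integrable_oc_itg.
have mf' : measurable_fun `]a, x[ f by exact/measurable_EFinP.
have mc : measurable_fun `]a, x] f.
  by apply/(measurable_fun_itv_bndo_bndcP (BRight a) x f).
apply/integrableP; split; first exact/measurable_EFinP.
rewrite -integral_itv_bndo_bndc//.
by apply: measurableT_comp => //.
Qed.

Lemma diverging_integ (x K : R) (f : R -> R) :
  (forall y, itg x y f) ->
  {ae mu, forall t, x < t -> 0 < f t} ->
  (\int[mu]_(t in `]x, +oo[) (f t)%:E = +oo)%E ->
  exists2 y, x <= y & K <= integ x y f.
Proof.
move=> fi f0 fy; apply: contrapT => nK.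
have bound y : x <= y -> integ x y f < K.
  by move=> xy; rewrite ltNge; apply/negP => Ky; apply: nK; exists y.
pose F n := `]x, x + n%:R]%classic.
have mF n : measurable_fun (F n) f.
  by apply: measurable_funS (itg_meas (fi (x + n%:R))) => //; apply: subset_itvr; rewrite bnd_simp.
have UF : \bigcup_n F n = `]x, +oo[%classic.
  apply/seteqP; split => [t [n _]|t] /=; rewrite /F /= !in_itv/= ?andbT; first by case/andP.
  move=> xt; exists (Num.truncn (t - x)).+1 => //=; rewrite in_itv/= xt/=.
  have : t - x < (Num.truncn (t - x)).+1%:R by exact: truncnS_gt.
  by rewrite ltrBlDl => /ltW.
have mU : measurable_fun `]x, +oo[ f.
  rewrite -UF; apply/(measurable_fun_bigcup _ (fun n => measurable_itv `]x, x + n%:R])).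
  exact: mF.
have nd : {homo F : n m / (n <= m)%N >-> (n <= m)%O}.
  move=> n m nm; apply/subsetPset; apply: subset_itvl.
  by rewrite bnd_simp lerD2l ler_nat.
have cv : (\int[mu]_(t in F n) (`|f t|)%:E @[n --> \oo] -->
    \int[mu]_(t in \bigcup_n F n) (`|f t|)%:E)%E.
  apply: ge0_nondecreasing_set_cvg_integral => // n; first exact: measurable_itv.
  by apply/measurable_EFinP; apply: measurableT_comp => //; exact: mF.
have Uy : (\int[mu]_(t in \bigcup_n F n) (`|f t|)%:E = +oo)%E.
  rewrite UF -fy; apply: ae_eq_integral => //.
  - by apply/measurable_EFinP; exact: measurableT_comp.
  - exact/measurable_EFinP.
  - apply: (@filterS _ _ aeF _ _ _ f0) => t ht /=.
    by rewrite in_itv/= andbT => xt; rewrite gtr0_norm// ht.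
move: cv; rewrite Uy => /cvgeyPge /(_ K) [n _ /(_ n (leqnn n))] /=.
have xn : x <= x + n%:R by rewrite lerDl.
have -> : (\int[mu]_(t in F n) (`|f t|)%:E)%E = (integ x (x + n%:R) f)%:E.
  transitivity (\int[mu]_(t in F n) (f t)%:E)%E.
    apply: ae_eq_integral; first exact: measurable_itv.
    - by apply/measurable_EFinP; apply: measurableT_comp => //; exact: mF.
    - by apply/measurable_EFinP; exact: mF.
    - apply: (@filterS _ _ aeF _ _ _ f0) => t ht /=.
      by rewrite /F/= in_itv/= => /andP[xt _]; rewrite gtr0_norm// ht.
  rewrite /F integral_itv_obnd_cbnd; last by apply/measurable_EFinP; exact: mF.
  by rewrite /integ /Rintegral fineK//; apply: integrable_fin_num => //; exact: fi.
by rewrite lee_fin leNgt bound.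
Qed.

(** Whenever S doubles, the integral of f / S increases by at least 1/2. *)
Lemma log_divergence (a : R) (S f : R -> R) :
  (forall x y, a < x -> primitive x y S f) ->
  {ae mu, forall t, a < t -> 0 < f t} ->
  (forall x, a < x -> 0 < S x) ->
  (forall x K, a < x -> exists2 y, x <= y & K <= integ x y f) ->
  forall x K, a < x -> exists2 y, x <= y & K <= integ x y (fun t => (S t)^-1 * f t).
Proof.
move=> pS f0 S0 div x K ax.
have S_mono s t : a < s -> s <= t -> S s <= S t.
  move=> as_ st; have [fi hS] := pS s t as_; rewrite -subr_ge0 hS//.
  apply: integ_ge0_ae => //.
  by apply: (@filterS _ _ aeF _ _ _ f0) => r hr sr _; apply/ltW/hr; lin_arith.
have irho s t : a < s -> s <= t -> itg s t (fun t => (S t)^-1 * f t).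
  move=> as_ st; have pSt := pS s t as_.
  apply: itgM; last by case: pSt.
  apply: primitive_bmeas; apply: (primitiveV st pSt) => r sr rt.
  by rewrite gt_eqF// S0//; lin_arith.
suff h n : exists2 y, x <= y & n%:R / 2 <= integ x y (fun t => (S t)^-1 * f t).
  have [y xy hy] := h (Num.truncn (2 * K)).+1; exists y => //.
  apply: le_trans hy.
  have : 2 * K < (Num.truncn (2 * K)).+1%:R by exact: truncnS_gt.
  by rewrite ler_pdivlMr// mulrC => /ltW.
elim: n => [|n [y xy IH]]; first by exists x => //; rewrite integ_pt mul0r.
have ay : a < y by lin_arith.
have [z yz hz] := div y (S y) ay.
exists z; first lin_arith.
have xz : x <= z by lin_arith.
rewrite (integ_split xy yz (irho x z ax xz)).
have Sz0 : 0 < S z by apply: S0; lin_arith.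
have Sy0 : 0 < S y by apply: S0.
have pSz := pS y z ay.
have : integ y z (fun t => (S z)^-1 * f t) <= integ y z (fun t => (S t)^-1 * f t).
  apply: le_integ_ae; [by apply: itgZ; case: pSz|exact: irho|].
  apply: (@filterS _ _ aeF _ _ _ f0) => t ht yt tz.
  have at_ : a < t by lin_arith.
  apply: ler_wpM2r; first exact/ltW/ht.
  have St0 := S0 t at_.
  by rewrite lef_pV2 ?posrE//; apply: S_mono.
have fyz : itg y z f by case: pSz.
rewrite integZ//.
have hS : S z - S y = integ y z f by case: pSz => _; apply.
have : 1/2 <= (S z)^-1 * integ y z f.
  rewrite -hS [X in _ <= X]mulrC ler_pdivlMr//; lin_arith.
rewrite -[n.+1%:R]natr1; lin_arith.
Qed.

End Divergence.

(** * From the perturbed equation to the Riccati equation *)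

Section IVP.
Context {R : realType}.
Notation mu := (@lebesgue_measure R).

(** The combination of the two fundamental solutions at a with the prescribed
data at x0. Their Wronskian is constantly 1, so the coefficients are
determined by the values at any single point, and vanish if u and w vanish
together. *)
Lemma linear_system_ivp (a x0 al be : R) (m n : R -> R) : a <= x0 ->
  (forall x, itg a x m) -> (forall x, itg a x n) -> (al, be) != (0, 0) ->
  exists u w : R -> R, [/\ u x0 = al, w x0 = be,
    forall x, primitive a x u (fun t => w t * m t),
    forall x, primitive a x w (fun t => u t * n t) &
    forall x, a <= x -> u x = 0 -> w x != 0].
Proof.
move=> ax0 im in_ ab0.
have [U [W [Ua Wa pU pW]]] := linear_system_exists 1 0 im in_.
have [V [Z [Va Za pV pZ]]] := linear_system_exists 0 1 im in_.
have wronski x : a <= x -> U x * Z x - V x * W x = 1.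
  move=> ax.
  have pD := primitiveB (primitiveM (pU x) (pZ x)) (primitiveM (pV x) (pW x)).
  have [_ hD] : primitive a x (fun t => U t * Z t - V t * W t) (fun=> 0).
    by apply: eq_primitive pD => // t _ _; ring.
  have := hD a x (lexx _) ax (lexx _).
  rewrite integ_cst// Ua Wa Va Za; lra.
(* Cramer's rule *)
pose c := al * Z x0 - be * V x0; pose d := be * U x0 - al * W x0.
have W0 := wronski x0 ax0.
exists (fun x => c * U x + d * V x), (fun x => c * W x + d * Z x); split.
- rewrite -[RHS]mulr1 -W0 /c /d; ring.
- rewrite -[RHS]mulr1 -W0 /c /d; ring.
- move=> x; apply: eq_primitive (primitiveD (primitiveZ c (pU x)) (primitiveZ d (pV x))) => // t _ _.
  ring.
- move=> x; apply: eq_primitive (primitiveD (primitiveZ c (pW x)) (primitiveZ d (pZ x))) => // t _ _.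
  ring.
- move=> x ax ux; apply/eqP => wx; have Wx := wronski x ax.
  have c0 : c = 0.
    rewrite -[LHS]mulr1 -Wx.
    transitivity ((c * U x + d * V x) * Z x - (c * W x + d * Z x) * V x); first by ring.
    by rewrite ux wx; ring.
  have d0 : d = 0.
    rewrite -[LHS]mulr1 -Wx.
    transitivity ((c * W x + d * Z x) * U x - (c * U x + d * V x) * W x); first by ring.
    by rewrite ux wx; ring.
  move: ab0; rewrite xpair_eqE negb_and => /orP[]/eqP; apply.
  + transitivity (c * U x0 + d * V x0); last by rewrite c0 d0; ring.
    by rewrite -[LHS]mulr1 -W0 /c /d; ring.
  + transitivity (c * W x0 + d * Z x0); last by rewrite c0 d0; ring.
    by rewrite -[LHS]mulr1 -W0 /c /d; ring.
Qed.

End IVP.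

Section Comparison.
Context {R : realType}.
Notation mu := (@lebesgue_measure R).
Let aeF := ae_filter_ringOfSetsType mu.

Variables (a : R) (m0 m1 n0 n1 u0 w0 S : R -> R).

(** With S' = m0 / u0^2 the following are rho = S'/S, rho Q, and the products
of rho with the two coefficients that tend to zero, all written without
dividing by m0. *)
Definition log_density t := (S t)^-1 * ((u0 t)^-1 * (u0 t)^-1 * m0 t).
Definition potential_term t :=
  S t * (u0 t ^+ 2 * (n1 t - n0 t) + w0 t ^+ 2 * (m0 t - m1 t)).
Definition mixed_term t := w0 t * (m0 t - m1 t) / u0 t.
Definition leading_term t := (S t)^-1 * ((u0 t)^-1 * (u0 t)^-1 * (m0 t - m1 t)).
(** S times the Wronskian u0 w1 - w0 u1, divided by u1 / u0. *)
Definition riccati_var (u1 w1 : R -> R) t :=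
  S t * (u0 t * u0 t) * w1 t * (u1 t)^-1 - S t * u0 t * w0 t.
Definition riccati_rhs (u1 w1 : R -> R) t :=
  log_density t * (riccati_var u1 w1 t - riccati_var u1 w1 t ^+ 2) + potential_term t
  + 2 * mixed_term t * riccati_var u1 w1 t
  + leading_term t * riccati_var u1 w1 t ^+ 2.

Hypothesis sys0 : is_system a m0 n0 u0 w0.
Hypothesis u0_gt0 : forall x, a < x -> 0 < u0 x.
Hypothesis S_gt0 : forall x, a < x -> 0 < S x.
Hypothesis pS : forall x y, a < x -> primitive x y S (fun t => (u0 t)^-1 * (u0 t)^-1 * m0 t).

Lemma riccati_var_primitive u1 w1 x y : is_system a m1 n1 u1 w1 ->
  a < x -> x <= y -> (forall t, x <= t -> t <= y -> u1 t != 0) ->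
  primitive x y (riccati_var u1 w1) (riccati_rhs u1 w1).
Proof.
move=> sys1 ax xy u10.
have [pu0 pw0] := sys0 y ax; have [pu1 pw1] := sys1 x y ax.
have pV := primitiveV xy pu1 u10.
have p1 := primitiveM (primitiveM (primitiveM (pS y ax) (primitiveM pu0 pu0)) pw1) pV.
have p2 := primitiveM (primitiveM (pS y ax) pu0) pw0.
apply: eq_primitive (primitiveB p1 p2) => // t xt ty.
have at_ : a < t by lra.
have u0t : u0 t != 0 by rewrite gt_eqF// u0_gt0.
have St : S t != 0 by rewrite gt_eqF// S_gt0.
have u1t := u10 t xt ty.
rewrite /riccati_rhs /riccati_var /log_density /potential_term /mixed_term /leading_term.
by field; rewrite u0t St u1t.
Qed.

Lemma quotient_primitive u1 w1 x y : is_system a m1 n1 u1 w1 ->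
  a < x -> x <= y ->
  primitive x y (fun t => u1 t * (u0 t)^-1)
    (fun t => (u0 t)^-1 * (w1 t * m1 t) + u1 t * - ((u0 t)^-1 * (u0 t)^-1 * (w0 t * m0 t))).
Proof.
move=> sys1 ax xy.
have [pu0 _] := sys0 y ax; have [pu1 _] := sys1 x y ax.
apply: (primitiveM pu1); apply: (primitiveV xy pu0) => t xt ty.
by rewrite gt_eqF// u0_gt0//; lra.
Qed.

(** The logarithmic derivative of u1 / u0 is rho ((1 - d) phi - c), hence
nonnegative as soon as phi is at least 1/2 and c, d are small. *)
Lemma quotient_density u1 w1 t : a < t -> u1 t != 0 ->
  (u0 t)^-1 * (w1 t * m1 t) + u1 t * - ((u0 t)^-1 * (u0 t)^-1 * (w0 t * m0 t)) =
  u1 t * (u0 t)^-1 * (log_density t * riccati_var u1 w1 t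
    - leading_term t * riccati_var u1 w1 t - mixed_term t).
Proof.
move=> at_ u1t.
have u0t : u0 t != 0 by rewrite gt_eqF// u0_gt0.
have St : S t != 0 by rewrite gt_eqF// S_gt0.
rewrite /riccati_var /log_density /mixed_term /leading_term.
by field; rewrite u0t St u1t.
Qed.

(** 2 |phi| and phi^2 are both at most 1 + phi^2. *)
Lemma perturbed_rhs (d : R) u1 w1 t : 0 < log_density t ->
  `|mixed_term t| <= d / 2 * log_density t ->
  `|leading_term t| <= d / 2 * log_density t ->
  perturbed_riccati d log_density potential_term (riccati_var u1 w1) (riccati_rhs u1 w1) t.
Proof.
rewrite /perturbed_riccati /riccati_rhs => r0 hc hd.
move: (riccati_var u1 w1 t) (log_density t) (potential_term t) (mixed_term t)
  (leading_term t) r0 hc hd => p r k c e r0 hc hd.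
have -> : r * (p - p ^+ 2) + k + 2 * c * p + e * p ^+ 2 - (r * (p - p ^+ 2) + k) =
  c * (2 * p) + e * p ^+ 2 by ring.
apply: (le_trans (ler_normD _ _)); rewrite (normrM c) (normrM 2) (normrM e).
have h1 : `|2 : R| * `|p| <= 1 + p ^+ 2.
  rewrite ger0_norm// -(real_normK (num_real p)); have : 0 <= (`|p| - 1) ^+ 2 by rewrite sqr_ge0.
  nra.
have h2 : `|p ^+ 2| = p ^+ 2 by rewrite ger0_norm// sqr_ge0.
have p2 : 0 <= p ^+ 2 by rewrite sqr_ge0.
have c0 : 0 <= `|c| by [].
have dr0 : 0 <= d / 2 * r by exact: le_trans hc.
have k1 : `|c| * (`|2 : R| * `|p|) <= d / 2 * r * (1 + p ^+ 2).
  by apply: ler_pM => //; rewrite mulr_ge0.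
have k2 : `|e| * `|p ^+ 2| <= d / 2 * r * p ^+ 2.
  by rewrite h2; apply: ler_wpM2r.
apply: (le_trans (lerD k1 k2)); rewrite -subr_ge0.
have -> : d * (r * (1 + p ^+ 2)) - (d / 2 * r * (1 + p ^+ 2) + d / 2 * r * p ^+ 2) =
  d / 2 * r by field.
exact: dr0.
Qed.

Variables (l C e M : R).
Hypotheses (l0 : 0 < l) (e0 : 0 < e) (C0 : 0 <= C) (aM : a <= M).
Hypothesis irho : forall x y, a < x -> itg x y log_density.
Hypothesis ikap : forall x y, a < x -> itg x y potential_term.
Hypothesis rho0 : {ae mu, forall t, M < t -> 0 < log_density t}.
Hypothesis kapC : {ae mu, forall t, M < t -> `|potential_term t| <= C * log_density t}.
Hypothesis mixed_small : forall d : R, 0 < d -> exists N,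
  {ae mu, forall t, N < t -> `|mixed_term t| <= d * log_density t}.
Hypothesis leading_small : forall d : R, 0 < d -> exists N,
  {ae mu, forall t, N < t -> `|leading_term t| <= d * log_density t}.

Lemma eventually_perturbed (d : R) : 0 < d -> exists2 N : R, M <= N &
  {ae mu, forall t, N < t -> 0 < log_density t /\
     (`|mixed_term t| <= d / 2 * log_density t /\
      `|leading_term t| <= d / 2 * log_density t)}.
Proof.
move=> d0; have d2 : 0 < d / 2 by lra.
have [N1 h1] := mixed_small d2; have [N2 h2] := leading_small d2.
exists (Num.max M (Num.max N1 N2)); first by rewrite le_max lexx.
apply: (@filterS3 _ _ aeF _ _ _ _ _ rho0 h1 h2) => t r0 r1 r2.
by rewrite !gt_max => /andP[? /andP[? ?]]; split; [exact: r0|split; [exact: r1|exact: r2]].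
Qed.

Lemma comparison_oscillation u1 w1 :
  (forall x K, a < x -> exists2 y, x <= y & K <= integ x y log_density) ->
  (forall x, M < x ->
     integ x (x + l) potential_term <= (- (1/4) - e) * integ x (x + l) log_density) ->
  is_system a m1 n1 u1 w1 -> ~ (exists N : R, forall x, N < x -> u1 x != 0).
Proof.
move=> div avg sys1 [N u1N].
have l0' := l0; have e0' := e0; have C0' := C0; have aM' := aM.
have e4 : 0 < e / 4 by rewrite divr_gt0.
have [d [d0 d4 de]] : exists d : R, [/\ 0 < d, d <= 1/4 & d <= e / 4].
  exists (Num.min (1/4) (e / 4)).
  by rewrite lt_min e4 !ge_min !lexx orbT divr_gt0.
have [N' MN' hN'] := eventually_perturbed d0.
have [K [NK NK']] : exists K : R, N <= K /\ N' <= K.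
  by exists (Num.max N N'); rewrite !le_max !lexx orbT.
have aK : a <= K by lra.
apply: (@riccati_oscillation R K l C e d log_density potential_term
  (riccati_var u1 w1) (riccati_rhs u1 w1)) => //.
- exact: ltW.
- by move=> x y Kx; apply: irho; lra.
- by move=> x y Kx; apply: ikap; lra.
- by apply: (@filterS _ _ aeF _ _ _ rho0) => t h Kt; apply: h; lra.
- by apply: (@filterS _ _ aeF _ _ _ kapC) => t h Kt; apply: h; lra.
- by move=> x k Kx; apply: div; lra.
- by move=> x Kx; apply: avg; lra.
- move=> x y Kx xy; apply: riccati_var_primitive => //; first lra.
  by move=> t xt _; apply: u1N; lra.
- apply: (@filterS _ _ aeF _ _ _ hN') => t h Kt.
  have [|r0 [h1 h2]] := h; first lra.
  exact: perturbed_rhs.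
Qed.

(** The solution starts at a far point x0 with phi = 1/2 + h. Were u1 / u0 to
descend from 1 to 1/2 after x0, it would be positive until then, so phi would be
defined and trapped above 1/2, and u1 / u0 nondecreasing. *)
Lemma comparison_nonoscillation : e <= 1/2 ->
  (forall x, itg a x m1) -> (forall x, itg a x n1) ->
  (forall h : R, 0 < h -> exists N : R, forall x, N < x -> integ x (x + l) log_density <= h) ->
  (forall x, M < x ->
     (- (1/4) + e) * integ x (x + l) log_density <= integ x (x + l) potential_term) ->
  exists (u1 w1 : R -> R) (x0 : R), [/\ a < x0,
    forall x, primitive a x u1 (fun t => w1 t * m1 t),
    forall x, primitive a x w1 (fun t => u1 t * n1 t),
    forall x, a <= x -> u1 x = 0 -> w1 x != 0 &
    forall x, x0 <= x -> 0 < u1 x].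
Proof.
move=> e2 im1 in1 small avg.
have l0' := l0; have e0' := e0; have C0' := C0; have aM' := aM.
have [d d0 dE] : exists2 d : R, 0 < d & d = e / 8.
  by exists (e / 8) => //; rewrite divr_gt0.
have [N MN hN] := eventually_perturbed d0.
(* h^2 <= e / 4 since e <= 1/2 *)
have [h h0 hE] : exists2 h : R, 0 < h & h = e / 4.
  by exists (e / 4) => //; rewrite divr_gt0.
have hC : 0 < h / (C + 1) / 2 by rewrite !divr_gt0//; lra.
have [N' smallN] := small _ hC.
have [x0 [NK NK']] : exists x0 : R, N < x0 /\ N' < x0.
  by exists (Num.max N N' + 1); rewrite !ltr_pwDr ?le_max ?lexx ?orbT.
have ax0 : a < x0 by lra.
have u00 := u0_gt0 ax0; have S00 := S_gt0 ax0.
(* the value of w1 that makes phi = 1/2 + h when u1 = u0 at x0 *)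
pose om := (1/2 + h + S x0 * u0 x0 * w0 x0) / (S x0 * u0 x0).
have [u1 [w1 [ux0 wx0 pu1 pw1 nz]]] := @linear_system_ivp R a x0 (u0 x0) om m1 n1
  (ltW ax0) im1 in1 ltac:(by rewrite xpair_eqE (gt_eqF u00)).
have sys1 : is_system a m1 n1 u1 w1.
  move=> x y ax; split.
    by apply: primitiveS (pu1 y); [exact: ltW|].
  by apply: primitiveS (pw1 y); [exact: ltW|].
have phi0 : riccati_var u1 w1 x0 = 1/2 + h.
  rewrite /riccati_var ux0 wx0 /om; field.
  by rewrite (gt_eqF u00) (gt_eqF S00).
exists u1, w1, x0; split => // x xx.
rewrite ltNge; apply/negP => ux.
have pq := quotient_primitive sys1 ax0 xx.
pose y t := u1 t * (u0 t)^-1.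
have yx0 : y x0 = 1 by rewrite /y ux0 mulfV// gt_eqF.
have yx : y x <= 1/2.
  apply: (@le_trans _ _ 0); last lra.
  by apply: mulr_le0_ge0 => //; rewrite invr_ge0 ltW// u0_gt0//; lra.
have [| | |s [t [[xs st tx] [ps pt lo _]]]] :=
  @down_crossing _ y x0 x 1 (1/2) xx (primitive_cont pq); rewrite ?yx0//; first lra.
have u1pos r : x0 <= r -> r <= t -> 0 < u1 r.
  move=> xr rt; have := lo r xr rt; rewrite /y => yr.
  have u0r : 0 < u0 r by apply: u0_gt0; lra.
  have : 0 < u1 r * (u0 r)^-1 by lra.
  by rewrite pmulr_lgt0// invr_gt0.
have xt : x0 <= t by lra.
have pphi : primitive x0 t (riccati_var u1 w1) (riccati_rhs u1 w1).
  by apply: riccati_var_primitive => // r xr rt; rewrite gt_eqF// u1pos.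
have trap : forall r, x0 <= r -> r <= t -> 1/2 <= riccati_var u1 w1 r.
  apply: (@riccati_trap R x0 t l C e d h log_density potential_term
    (riccati_var u1 w1) (riccati_rhs u1 w1)) => //.
  - exact: ltW.
  - by lra.
  - by lra.
  - by rewrite hE; nra.
  - by move=> p q xp; apply: irho; lra.
  - by move=> p q xp; apply: ikap; lra.
  - by apply: (@filterS _ _ aeF _ _ _ rho0) => r hr xr; apply: hr; lra.
  - by apply: (@filterS _ _ aeF _ _ _ kapC) => r hr xr; apply: hr; lra.
  - move=> p xp; have := smallN p ltac:(lra) => hp.
    have := ler_wpM2l C0 hp.
    have -> : C * (h / (C + 1) / 2) = h / 2 - h / (C + 1) / 2.
      by field; rewrite gt_eqF//; lra.
    lra.
  - by move=> p xp; apply: avg; lra.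
  - apply: (@filterS _ _ aeF _ _ _ hN) => r hr xr rt.
    have [|r0 [h1 h2]] := hr; first lra.
    exact: perturbed_rhs.
have [gi hy] := primitiveS (lexx x0) tx pq.
have yt : y t - y x0 = _ := hy x0 t (lexx _) xt (lexx _).
suff : 0 <= y t - y x0 by rewrite pt yx0; lra.
rewrite yt; apply: integ_ge0_ae => //.
apply: (@filterS _ _ aeF _ _ _ hN) => r hr xr rt.
have [|r0 [h1 h2]] := hr; first lra.
have ar : a < r by lra.
have u1r := u1pos r xr rt.
rewrite quotient_density//; last by rewrite gt_eqF.
apply: mulr_ge0; first by rewrite mulr_ge0 ?invr_ge0 ?ltW// u0_gt0.
have := trap r xr rt.
move: (riccati_var u1 w1 r) (log_density r) (mixed_term r) (leading_term r) r0 h1 h2.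
move=> p q c k q0; rewrite !ler_norml => /andP[_ c2] /andP[_ k2] p2.
have dq : d / 2 * q <= 1/32 * q by apply: ler_wpM2r; [exact: ltW | lra].
have p0 : 0 <= p by lra.
have h3 : k * p <= 1/32 * q * p by apply: ler_wpM2r => //; lra.
have h4 : q * (1/2) <= q * p by apply: ler_wpM2l => //; exact: ltW.
lra.
Qed.

End Comparison.

(** * Eventual bounds, and the oscillation criterion *)

Section Glue.
Context {R : realType}.
Notation mu := (@lebesgue_measure R).
Let aeF := ae_filter_ringOfSetsType mu.

Lemma itg_cat (a c x : R) (f : R -> R) : a <= c -> c <= x ->
  itg a c f -> itg c x f -> itg a x f.
Proof.
move=> ac cx f1 f2.
have f3 : mu.-integrable `]c, x] (EFin \o f).
  by apply: integrableS f2 => //; apply: subset_itv; rewrite bnd_simp.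
have e : `[a, x]%classic = `[a, c]%classic `|` `]c, x]%classic.
  by apply: (@itv_bndbnd_setU _ _ _ (BRight c)); rewrite bnd_simp.
have mf : measurable_fun `[a, x] f.
  rewrite e; apply/measurable_funU => //; split; first exact: itg_meas f1.
  by case/integrableP: f3 => /measurable_EFinP.
apply/integrableP; split; first exact/measurable_EFinP.
rewrite e ge0_integral_setU//=.
- apply: lte_add_pinfty; first by case/integrableP: f1.
  by case/integrableP: f3.
- by rewrite -e; apply/measurable_EFinP; exact: measurableT_comp.
- apply/disj_setPS => y /=; rewrite !in_itv/= => -[/andP[_ yc] /andP[cy _]].
  by have := lt_le_trans cy yc; rewrite ltxx.
Qed.

Lemma regular_itg (a : R) (f : R -> R) : locally_integrable `]a, +oo[ f ->
  integrable_near_left a f -> forall x, itg a x f.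
Proof.
move=> lf [c ac fc] x.
have fac := integrable_oo_itg fc.
have [xc|cx] := leP x c; first exact: itgS fac.
apply: itg_cat fac _; [exact: ltW|exact: ltW|].
exact: locally_integrable_itg lf _ _ ac.
Qed.

Lemma itg_empty (x y : R) (f : R -> R) : y < x -> itg x y f.
Proof.
move=> yx; rewrite /itg set_itv_ge ?bnd_simp -?ltNge//; exact: integrable_set0.
Qed.

Lemma itg_ae_bounded (x y C : R) (f : R -> R) : measurable_fun `[x, y] f ->
  {ae mu, forall t, x <= t -> t <= y -> `|f t| <= C} -> itg x y f.
Proof.
move=> mf fC; apply/integrableP; split; first exact/measurable_EFinP.
apply: le_lt_trans.
  apply: (integral_le_bound (`|C|)%:E) => //; first exact/measurable_EFinP.
  apply: (@filterS _ _ aeF _ _ _ fC) => t h; rewrite /= in_itv/= => /andP[xt ty].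
  by rewrite lee_fin; apply: le_trans (h xt ty) (ler_norm _).
rewrite lte_mul_pinfty//= lebesgue_measure_itv.
by case: ifP => _; rewrite ?ltry// -EFinB ltry.
Qed.

Lemma ae_neq (a : R) : {ae mu, forall t, t != a}.
Proof.
exists [set a]; split; [by []|exact: lebesgue_measure_set1|].
by move=> t /= /negP; rewrite negbK => /eqP.
Qed.

Lemma limsup_lt_eventually (F : R -> R) (c : R) :
  (limf_esup (fun x => (F x)%:E) (+oo%R : set_system R) < c%:E)%E ->
  exists2 q : R, q < c & exists N, forall x, N < x -> F x <= q.
Proof.
rewrite limf_esupE => /ereal_inf_lt[_ [V [N [_ hN]] <-] lt].
have le x : N < x -> ((F x)%:E <= ereal_sup ((fun x => (F x)%:E) @` V))%E.
  by move=> Nx; apply: ereal_sup_ubound; exists x => //; exact: hN.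
move: lt le; case: ereal_sup => [s||] lt le.
- by exists s; [rewrite lte_fin in lt | exists N => x /le; rewrite lee_fin].
- by [].
- by have := le (N + 1) (ltac:(by rewrite ltrDl)).
Qed.

Lemma finite_set_ub (A : set R) : finite_set A -> exists N, forall x, A x -> x <= N.
Proof.
move=> /finite_compact/compact_bounded[M [_ hM]]; exists (M + 1) => x Ax.
apply: le_trans (ler_norm x) _; apply: hM => //=; by rewrite ltrDl.
Qed.

End Glue.

Theorem theorem2p5 (R : realType) (a E l : R) (p0 p1 q0 q1 r u0 : R -> R)
    (hc0 : coefficients a p0 q0 r) (hc1 : coefficients a p1 q1 r)
    (hreg0 : regular_left a p0 q0 r) (hreg1 : regular_left a p1 q1 r)
    (hlp0 : limit_point_infty a p0 q0 r) (hlp1 : limit_point_infty a p1 q1 r)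
    (hl : 0 < l)
    (hu0 : minimal_positive_solution a p0 q0 r E u0)
    (* the integral defining v0 converges at a *)
    (hint : forall x, a < x ->
      (@lebesgue_measure R).-integrable `]a, x]
        (fun t => ((p0 t * u0 t ^+ 2)^-1)%:E)) :
  let v0 := second_solution a p0 u0 in
  let pu0' := fun x => p0 x * derive1 u0 x in
  let dp := Delta_p p0 p1 in
  let dq := Delta_q q0 q1 in
  let rho := fun x => (p0 x * u0 x * v0 x)^-1 in
  let Q := fun x =>
    p0 x * v0 x ^+ 2 * (u0 x ^+ 2 * dq x + pu0' x ^+ 2 * dp x) in
  let avgQ := fun x =>
    l^-1 * (\int[lebesgue_measure]_(t in `[x, (x + l)%R]) Q t) in
  Q =O_ess_pinfty (cst (1 : R)) ->
  (p0 x * v0 x * pu0' x * dp x) @[x --> ess_pinfty] --> (0 : R) ->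
  (p0 x * dp x) @[x --> ess_pinfty] --> (0 : R) ->
  rho =o_ess_pinfty (cst (1 : R)) ->
  (fun x => l^-1 * (\int[lebesgue_measure]_(t in `[0%R, l])
     `|rho (x + t) - rho x|)) =o_ess_pinfty rho ->
  ((limf_esup (fun x => (avgQ x)%:E) (+oo%R : set_system R) < (- (1 / 4))%:E)%E ->
     oscillatory a p1 q1 r E) /\
  ((limf_einf (fun x => (avgQ x)%:E) (+oo%R : set_system R) > (- (1 / 4))%:E)%E ->
     nonoscillatory a p1 q1 r E).
Proof.
move=> v0 pu0' dp dq rho Q avgQ hQO hmix hlead hrho hosc.
have aeF := ae_filter_ringOfSetsType (@lebesgue_measure R).
case: (hu0) => [sol0 u0_gt0 hdiv].
have [lp0 lq0 lr pr0] := hc0; have [lp1 lq1 _ pr1] := hc1.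
have [w0 sys0 w0E] := solution_system hc0 sol0.
pose m0 t := (p0 t)^-1; pose m1 t := (p1 t)^-1.
pose n0 t := q0 t - E * r t; pose n1 t := q1 t - E * r t.
rewrite -/m0 -/n0 in sys0.
pose S x := \int[lebesgue_measure]_(t in `]a, x]) (p0 t * u0 t ^+ 2)^-1.
pose f t := (u0 t)^-1 * (u0 t)^-1 * m0 t.
have fE t : (p0 t * u0 t ^+ 2)^-1 = f t.
  by rewrite /f /m0 expr2 !invfM; ring.
have fi x : itg a x f.
  have [xa|ax] := leP x a; last first.
    apply: eq_itg (integrable_oc_itg (hint x ax)) => t _ _; exact: fE.
  move: xa; rewrite le_eqVlt => /orP[/eqP ->|]; last exact: itg_empty.
  by apply: (@itgS _ a (a + 1)); [|rewrite lerDl|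
    apply: eq_itg (integrable_oc_itg (hint (a + 1) (ltac:(by rewrite ltrDl)))) => t _ _; exact: fE].
have SE x : a < x -> S x = integ a x f.
  move=> ax; rewrite /S Rintegral_itv_obnd_cbnd; last exact: hint.
  by apply: eq_integ => t _ _; exact: fE.
have pS x y : a < x -> primitive x y S f.
  move=> ax; apply: (@eq_primitive _ x y (fun y => 0 + integ a y f) _ f) => //.
    by move=> t xt _; rewrite add0r SE//; lin_arith.
  apply: (@primitiveS _ a y) => //; first exact: ltW.
  exact: primitive_integ.
have f_gt0 : {ae (@lebesgue_measure R), forall t, a < t -> 0 < f t}.
  apply: (@filterS _ _ aeF _ _ _ pr0) => t h at_; have [p0t _] := h at_.
  by rewrite /f !mulr_gt0// ?invr_gt0// u0_gt0.
have S_gt0 x : a < x -> 0 < S x.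
  move=> ax; rewrite SE//; apply: integ_gt0_ae => //.
  apply: (@filterS2 _ _ aeF _ _ _ _ f_gt0 (ae_neq a)) => t h ta at_ _.
  by apply: h; rewrite lt_neqAle eq_sym ta.
have div x K : a < x -> exists2 y, x <= y & K <= integ x y f.
  move=> ax; apply: diverging_integ.
  - by move=> y; apply: itgS (fi y); [exact: ltW|].
  - by apply: (@filterS _ _ aeF _ _ _ f_gt0) => t h xt; apply: h; lin_arith.
  - by rewrite -(hdiv x ax); apply: eq_integral => t _; rewrite fE.
pose rh := log_density m0 u0 S; pose kap := potential_term m0 m1 n0 n1 u0 w0 S.
have bu0 x y : a < x -> bmeas x y u0.
  by move=> ax; apply: primitive_bmeas (sys0 x y ax).1.
have bw0 x y : a < x -> bmeas x y w0.
  by move=> ax; apply: primitive_bmeas (sys0 x y ax).2.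
have bS x y : a < x -> bmeas x y S.
  by move=> ax; apply: primitive_bmeas (pS x y ax).
have irho x y : a < x -> itg x y rh.
  move=> ax; have [xy|yx] := leP x y; last exact: itg_empty.
  apply: itgM; last by apply: itgS (fi y); [exact: ltW|].
  apply: primitive_bmeas; apply: (primitiveV xy (pS x y ax)) => t xt _.
  by rewrite gt_eqF// S_gt0//; lin_arith.
have im x y (p : R -> R) : a < x -> locally_integrable `]a, +oo[ p -> itg x y p.
  by move=> ax lp; exact: locally_integrable_itg lp x y ax.
have ikap x y : a < x -> itg x y kap.
  move=> ax; have b0 := bu0 x y ax; have b1 := bw0 x y ax.
  apply: itgM; first exact: bS.
  apply: itgD; apply: itgM.
  - by have := bmeasM b0 b0.
  - by apply: itgB; apply: itgB; try (exact: im); apply: itgZ; exact: im.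
  - by have := bmeasM b1 b1.
  - by apply: itgB; exact: im.
have rhoE x : rho x = rh x.
  rewrite /rho /v0 /second_solution -/(S x) /rh /log_density /m0 !invfM; ring.
have rh_gt0 : {ae (@lebesgue_measure R), forall t, a < t -> 0 < rh t}.
  apply: (@filterS _ _ aeF _ _ _ f_gt0) => t h at_.
  by rewrite /rh /log_density mulr_gt0 ?invr_gt0 ?S_gt0//; exact: h.
have good : {ae (@lebesgue_measure R), forall t, a < t ->
    [/\ 0 < p0 t, 0 < p1 t, pu0' t = w0 t & 0 < rh t]}.
  have h2 := @filterI _ _ aeF _ _ rh_gt0 pr1.
  apply: (@filterS3 _ _ aeF _ _ _ _ _ pr0 w0E h2) => t h3 h4 [h5 h6] at_.
  split; [by case: (h3 at_)|by case: (h6 at_)|by rewrite h4|exact: h5].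
have mixed_small d : 0 < d -> exists N, {ae (@lebesgue_measure R), forall t,
    N < t -> `|mixed_term m0 m1 u0 w0 t| <= d * rh t}.
  move=> d0; move/cvgrPdist_le : hmix => /(_ d d0) [N hN].
  exists (Num.max a N); apply: (@filterS2 _ _ aeF _ _ _ _ hN good) => t h h'.
  rewrite gt_max => /andP[at_ Nt]; have [p0t p1t ut rt] := h' at_.
  have := h Nt; rewrite sub0r normrN ut => ct.
  have u0t := u0_gt0 t at_; have St := S_gt0 t at_.
  have -> : mixed_term m0 m1 u0 w0 t = p0 t * v0 t * w0 t * dp t * rh t.
    rewrite /mixed_term /rh /log_density /v0 /second_solution -/(S t) /dp /Delta_p /m0 /m1.
    by field; rewrite !gt_eqF.
  by rewrite normrM (gtr0_norm rt); apply: ler_wpM2r => //; exact: ltW.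
have leading_small d : 0 < d -> exists N, {ae (@lebesgue_measure R), forall t,
    N < t -> `|leading_term m0 m1 u0 S t| <= d * rh t}.
  move=> d0; move/cvgrPdist_le : hlead => /(_ d d0) [N hN].
  exists (Num.max a N); apply: (@filterS2 _ _ aeF _ _ _ _ hN good) => t h h'.
  rewrite gt_max => /andP[at_ Nt]; have [p0t p1t ut rt] := h' at_.
  have := h Nt; rewrite sub0r normrN => ct.
  have u0t := u0_gt0 t at_; have St := S_gt0 t at_.
  have -> : leading_term m0 m1 u0 S t = p0 t * dp t * rh t.
    rewrite /leading_term /rh /log_density /dp /Delta_p /m0 /m1.
    by field; rewrite !gt_eqF.
  by rewrite normrM (gtr0_norm rt); apply: ler_wpM2r => //; exact: ltW.
(* the coefficient Q with w0 in place of p0 u0': equal almost everywhere, and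
   measurable *)
pose Qt t := p0 t * v0 t ^+ 2 * (u0 t ^+ 2 * dq t + w0 t ^+ 2 * dp t).
have kapE : {ae (@lebesgue_measure R), forall t, a < t -> kap t = rh t * Qt t}.
  apply: (@filterS _ _ aeF _ _ _ good) => t h' at_; have [p0t p1t ut rt] := h' at_.
  have u0t := u0_gt0 t at_; have St := S_gt0 t at_.
  rewrite /kap /potential_term /rh /log_density /Qt /v0 /second_solution -/(S t)
    /dp /Delta_p /dq /Delta_q /n1 /n0 /m0 /m1.
  by field; rewrite !gt_eqF.
have [C [M0 [C0 aM0 QC]]] : exists C M0, [/\ 0 <= C, a <= M0 &
    {ae (@lebesgue_measure R), forall t, M0 < t -> `|Qt t| <= C}].
  move/eqOP : hQO => [K [_ hK]].
  have [N hN] := hK (Num.max K 0 + 1) (ltac:(by rewrite /= ltr_pwDr ?le_max ?lexx)).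
  exists (Num.max K 0 + 1), (Num.max a N); split.
  - by rewrite addr_ge0 ?le_max ?lexx ?orbT.
  - by rewrite le_max lexx.
  apply: (@filterS2 _ _ aeF _ _ _ _ hN good) => t h h'.
  rewrite gt_max => /andP[at_ Nt]; have [p0t p1t ut rt] := h' at_.
  by have := h Nt; rewrite /= normr1 mulr1 /Q ut.
have mQ x y : a < x -> measurable_fun `[x, y] Qt.
  move=> ax.
  have mu0 : measurable_fun `[x, y] u0 by case: (bu0 x y ax).
  have mw0 : measurable_fun `[x, y] w0 by case: (bw0 x y ax).
  have mS : measurable_fun `[x, y] S by case: (bS x y ax).
  have mm0 : measurable_fun `[x, y] m0 by exact: itg_meas (im x y _ ax lp0).
  have mm1 : measurable_fun `[x, y] m1 by exact: itg_meas (im x y _ ax lp1).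
  have mq0 : measurable_fun `[x, y] q0 by exact: itg_meas (im x y _ ax lq0).
  have mq1 : measurable_fun `[x, y] q1 by exact: itg_meas (im x y _ ax lq1).
  have mp0 : measurable_fun `[x, y] p0.
    apply: eq_measurable_fun (measurable_invr mm0) => t _; by rewrite /m0 invrK.
  have mv0 : measurable_fun `[x, y] v0 by exact: measurable_funM.
  apply: measurable_funM.
    by apply: measurable_funM => //; exact: measurable_funX.
  by apply: measurable_funD; apply: measurable_funM;
    [exact: measurable_funX|exact: measurable_funB|exact: measurable_funX|exact: measurable_funB].
have iQ x y : M0 < x -> itg x y Qt.
  move=> Mx; apply: (itg_ae_bounded (C := C)); first by apply: mQ; lin_arith.
  by apply: (@filterS _ _ aeF _ _ _ QC) => t h xt _; apply: h; lin_arith.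
have avgE x : M0 < x -> avgQ x = l^-1 * integ x (x + l) Qt.
  move=> Mx; congr (_ * _); apply: Rintegral_ae_eq.
  apply: (@filterS _ _ aeF _ _ _ good) => t h; rewrite /= in_itv/= => /andP[xt _].
  have [|_ _ ut _] := h; first lin_arith.
  by rewrite /Q /Qt ut.
have osc d : 0 < d -> exists2 N, M0 <= N & {ae (@lebesgue_measure R), forall x,
    N < x -> integ x (x + l) (fun t => `|rh t - rh x|) <= d * rh x}.
  move=> d0; move/eqoP : hosc => /(_ (d / l) (divr_gt0 d0 hl)) [N hN].
  exists (Num.max M0 N); first by rewrite le_max lexx.
  apply: (@filterS2 _ _ aeF _ _ _ _ hN good) => x h h'.
  rewrite gt_max => /andP[Mx Nx]; have ax : a < x by exact: le_lt_trans Mx.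
  have [_ _ _ rx] := h' ax; have := h Nx.
  have := @integ_shift R x l (fun t => rho t - rho x).
  have mrho : measurable_fun `[x, x + l] (fun t => rho t - rho x).
    apply: measurable_funB => //.
    by apply: eq_measurable_fun (itg_meas (irho x (x + l) ax)) => t _; rewrite rhoE.
  move=> /(_ mrho) ->; rewrite rhoE (gtr0_norm rx).
  move=> /(le_trans (ler_norm _)); rewrite -mulrA ler_pdivrMl// => H.
  rewrite (@eq_integ _ x (x + l) _ (fun t => `|rho t - rho x|)); last by move=> t _ _; rewrite !rhoE.
  have -> : d * rh x = l * (d * (l^-1 * rh x)) by field; rewrite gt_eqF.
  by rewrite rhoE.
(* the sign sg lets one statement serve both halves *)
have window sg q e : `|sg| <= 1 -> 0 < e -> (exists N, forall x, N < x -> sg * avgQ x <= q) ->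
    exists2 N, M0 <= N & forall x, N < x ->
      sg * integ x (x + l) kap <= (q + e) * integ x (x + l) rh.
  move=> sg1 e0 [N hN].
  have D0 : 0 < C + `|q + e| + 1 by rewrite ltr_wpDl// addr_ge0.
  pose d := e * l / (C + `|q + e| + 1).
  have d0 : 0 < d by rewrite divr_gt0 ?mulr_gt0.
  have [N' MN' hN'] := osc d d0.
  exists (Num.max N N'); first by rewrite le_max MN' orbT.
  move=> x Nx; rewrite -integZ; last first.
    apply: ikap; apply: le_lt_trans aM0 _; apply: le_lt_trans MN' _.
    by move: Nx; rewrite gt_max => /andP[].
  have Mle t : Num.max N N' < t -> [/\ a < t, M0 < t, N < t & N' < t].
    rewrite gt_max => /andP[Nt N't]; have Mt : M0 < t by exact: le_lt_trans N't.
    by split => //; exact: le_lt_trans Mt.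
  apply: (@averaged_le R (Num.max N N') l C q e d rh (fun t => sg * Qt t)
    (fun t => sg * kap t)) => //.
  - by move=> u v /Mle[au _ _ _]; exact: irho.
  - by move=> u v /Mle[au _ _ _]; apply: itgZ; exact: ikap.
  - by move=> u v /Mle[_ Mu _ _]; apply: itgZ; exact: iQ.
  - by apply: (@filterS _ _ aeF _ _ _ rh_gt0) => t h /Mle[at_ _ _ _]; exact: h.
  - apply: (@filterS _ _ aeF _ _ _ QC) => t h /Mle[_ Mt _ _].
    rewrite normrM -[C]mul1r; apply: ler_pM => //; exact: h.
  - apply: (@filterS _ _ aeF _ _ _ kapE) => t h /Mle[at_ _ _ _].
    by rewrite h// mulrCA.
  - exact: ltW.
  - rewrite /d mulrAC ler_pdivrMr//; apply: ler_wpM2l; last by rewrite lerDl.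
    by rewrite mulr_ge0// ltW.
  - by apply: (@filterS _ _ aeF _ _ _ hN') => t h /Mle[_ _ _ Nt]; exact: h.
  - move=> t /Mle[_ Mt Nt _]; have := hN t Nt; rewrite avgE// integZ; last exact: iQ.
    by rewrite mulrCA ler_pdivrMl// mulrC [l * q]mulrC [_ * sg]mulrC.
have small h : 0 < h -> exists N, forall x, N < x -> integ x (x + l) rh <= h.
  move=> h0; move/eqoP : hrho => /(_ (h / l) (divr_gt0 h0 hl)) [N hN].
  exists (Num.max a N) => x; rewrite gt_max => /andP[ax Nx].
  have -> : h = integ x (x + l) (fun=> h / l).
    rewrite integ_cst ?lerDl ?ltW//; field; by rewrite gt_eqF.
  apply: le_integ_ae; [exact: irho|exact: itg_cst|].
  apply: (@filterS _ _ aeF _ _ _ hN) => t ht xt _.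
  have := ht (lt_le_trans Nx xt); rewrite /= normr1 mulr1 rhoE.
  exact: le_trans (ler_norm _).
have kapC N : M0 <= N -> {ae (@lebesgue_measure R), forall t, N < t -> `|kap t| <= C * rh t}.
  move=> MN; apply: (@filterS3 _ _ aeF _ _ _ _ _ kapE QC good) => t h1 h2 h3 Nt.
  have Mt : M0 < t by exact: le_lt_trans Nt.
  have at_ : a < t by exact: le_lt_trans Mt.
  have [_ _ _ rt] := h3 at_.
  by rewrite h1// normrM (gtr0_norm rt) mulrC; apply: ler_wpM2r; [exact: ltW|exact: h2].
have rh0 N : M0 <= N -> {ae (@lebesgue_measure R), forall t, N < t -> 0 < rh t}.
  move=> MN; apply: (@filterS _ _ aeF _ _ _ rh_gt0) => t h Nt; apply: h.
  by apply: le_lt_trans aM0 _; exact: le_lt_trans Nt.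
have im1 x : itg a x m1 by apply: regular_itg => //; case: hreg1.
have in1 x : itg a x n1.
  by apply: itgB; [|apply: itgZ]; apply: regular_itg => //; case: hreg1.
split.
- move=> /limsup_lt_eventually[q qlt [N hN]] [u [solu [x1 ax1 ux1] fin]].
  (* half of the gap is spent on the averaging *)
  pose e := (- (1/4) - q) / 2.
  have e0 : 0 < e by rewrite divr_gt0// subr_gt0.
  have n1le : `|1 : R| <= 1 by rewrite normr1.
  have avg1 : exists N, forall x, N < x -> 1 * avgQ x <= q.
    by exists N => x Nx; rewrite mul1r; apply: (hN x Nx).
  have [N' MN' hN'] := window 1 q e n1le e0 avg1.
  have [w1 sys1 _] := solution_system hc1 solu.
  have [B hB] := finite_set_ub fin.
  apply: (@comparison_oscillation R a m0 m1 n0 n1 u0 w0 S sys0 u0_gt0 S_gt0 pS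
    l C e N' hl e0 C0 (le_trans aM0 MN') irho ikap (rh0 N' MN') (kapC N' MN')
    mixed_small leading_small u w1 _ _ sys1).
  + exact: (log_divergence pS f_gt0 S_gt0 div).
  + move=> x Nx; have := hN' x Nx; rewrite mul1r.
    by have -> : q + e = - (1/4) - e by rewrite /e; field.
  + exists (Num.max a B) => x; rewrite gt_max => /andP[ax Bx].
    apply/eqP => ux; have := hB x (conj ax ux); by rewrite leNgt Bx.
- rewrite /limf_einf lteNr => hlim.
  have [q qlt [N hN]] := @limsup_lt_eventually R (fun x => - avgQ x) (1/4)
    (ltac:(by rewrite -[1/4]opprK)).
  pose e := Num.min (1/2) ((1/4 - q) / 2).
  have e0 : 0 < e by rewrite lt_min !divr_gt0// subr_gt0.
  have e2 : e <= 1/2 by rewrite /e ge_min lexx.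
  have eq_ : q <= 1/4 - 2 * e.
    have : e <= (1/4 - q) / 2 by rewrite /e ge_min lexx orbT.
    by move: (e) => e'; lin_arith.
  have n1le : `|-1 : R| <= 1 by rewrite normrN normr1.
  have avg1 : exists N, forall x, N < x -> -1 * avgQ x <= 1/4 - 2 * e.
    by exists N => x Nx; rewrite mulN1r; apply: le_trans (hN x Nx) eq_.
  have [N' MN' hN'] := window (-1) (1/4 - 2 * e) e n1le e0 avg1.
  have avg2 x : N' < x -> (- (1/4) + e) * integ x (x + l) rh <= integ x (x + l) kap.
    move=> Nx; have := hN' x Nx; rewrite mulN1r.
    have -> : 1/4 - 2 * e + e = - (- (1/4) + e) by ring.
    by rewrite mulNr lerN2.
  have [u1 [w1 [x0 [ax0 pu1 pw1 nz pos]]]] :=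
    @comparison_nonoscillation R a m0 m1 n0 n1 u0 w0 S sys0 u0_gt0 S_gt0 pS
    l C e N' hl e0 C0 (le_trans aM0 MN') irho ikap (rh0 N' MN') (kapC N' MN')
    mixed_small leading_small e2 im1 in1 small avg2.
  exists u1; split.
  + apply: (@system_solution R a p1 q1 r E u1 w1 hc1) => x y ax; split.
      by apply: primitiveS (pu1 y); [exact: ltW|].
    by apply: primitiveS (pw1 y); [exact: ltW|].
  + by exists x0 => //; rewrite gt_eqF// pos.
  + apply: (@sub_finite_set _ _ [set x | [/\ a <= x, x <= x0 & u1 x = 0]]).
      move=> x [ax ux]; split => //; first exact: ltW.
      rewrite leNgt; apply/negP => xx; have := pos x (ltW xx).
      by rewrite ux ltxx.
    apply: (finite_zeros (ltW ax0) (im1 x0) _ (pu1 x0) (pw1 x0)).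
      apply: (@filterS2 _ _ aeF _ _ _ _ pr1 (ae_neq a)) => t h ta at_ _.
      rewrite /m1 invr_gt0; case: h => //.
      by rewrite lt_neqAle eq_sym ta.
    by move=> x ax _; exact: nz.
Qed.
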